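(* Let $\mathrm{Aut}(L_{2,4})$ be the group of linear automorphisms of $L_{2,4}$, let $\mathbb P\mathrm{Aut}(L_{2,4})$ be its quotient by the nonzero complex scalar matrices, let $\mathrm{Aut}_{\mathbb R}(L_{2,4})$ be the subgroup of real matrices in $\mathrm{Aut}(L_{2,4})$, and let $\mathbb P_+\mathrm{Aut}_{\mathbb R}(L_{2,4})$ be the quotient of $\mathrm{Aut}_{\mathbb R}(L_{2,4})$ by positive real scalar matrices. Then: (1) $\mathbb P\mathrm{Aut}(L_{2,4})$ has order $11520=768\cdot 15$ and is generated by classes of linear automorphisms of $L_{2,4}$ whose matrices have rational entries. (2) $\mathbb P_+\mathrm{Aut}_{\mathbb R}(L_{2,4})$ has order $23040$ and is isomorphic to the Weyl group $D_6$. (3) The set of non-negative elements of $\mathbb P_+\mathrm{Aut}_{\mathbb R}(L_{2,4})$ (classes containing a matrix with all entries real and non-negative) is a subgroup of order $24$, and it acts by relabeling the vertices of $K_4$ (its elements are the classes of the edge permutations of $K_4$ induced by permutations of the four vertices).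
   Context: Coordinates of $\mathbb C^6$ are indexed by the six edges $\{i,j\}$ of $K_4$. For a complex configuration ${\bf p}=({\bf p}_1,\dots,{\bf p}_4)$ in $\mathbb C^2$, $m({\bf p})\in\mathbb C^6$ has coordinates $m_{ij}({\bf p})=\sum_{k=1}^2({\bf p}_i^k-{\bf p}_j^k)^2$ (no conjugation); $M_{2,4}$ is the image of $m$. With $s:\mathbb C^6\to\mathbb C^6$ the coordinatewise squaring map, $L_{2,4}=s^{-1}(M_{2,4})$. A linear automorphism of $L_{2,4}$ is a non-singular $6\times 6$ complex matrix mapping $L_{2,4}$ bijectively onto itself. A class in $\mathbb P_+\mathrm{Aut}_{\mathbb R}(L_{2,4})$ is called non-negative if it contains a matrix with only real non-negative entries (then all its members are such). *)

(* Defs.v *)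
From mathcomp Require Import all_boot all_order all_algebra.
From mathcomp Require Import perm reals complex.
Set Implicit Arguments. Unset Strict Implicit. Unset Printing Implicit Defensive.
Import Order.TTheory GRing.Theory Num.Theory.
Local Open Scope ring_scope.
Local Open Scope complex_scope.

Section Defs.
Variable R : realType.
Notation C := (R[i]).

Definition edge (e : 'I_6) : 'I_4 * 'I_4 :=
  nth (inord 0, inord 1)
    [:: (inord 0, inord 1); (inord 0, inord 2); (inord 0, inord 3);
        (inord 1, inord 2); (inord 1, inord 3); (inord 2, inord 3)] e.

(* m(p)_{ij} = sum_k (p_i^k - p_j^k)^2, for p a configuration of 4 points in C^2
   (row i of p is the point p_i). *)
Definition mK4 (p : 'M[C]_(4, 2)) : 'cV[C]_6 :=
  \col_(e < 6) \sum_(k < 2) (p (edge e).1 k - p (edge e).2 k) ^+ 2.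

Definition M24 (x : 'cV[C]_6) : Prop := exists p : 'M[C]_(4, 2), x = mK4 p.

Definition sq (x : 'cV[C]_6) : 'cV[C]_6 := map_mx (fun z => z ^+ 2) x.

Definition L24 (x : 'cV[C]_6) : Prop := M24 (sq x).

Definition isAut (A : 'M[C]_6) : Prop :=
  A \in unitmx /\ (forall y, L24 y <-> exists x, L24 x /\ y = A *m x).

Definition real_mx (A : 'M[C]_6) : Prop := forall i j, A i j \is Num.real.
Definition rat_mx (A : 'M[C]_6) : Prop := forall i j, exists q : rat, A i j = ratr q.
(* in the order of R[i], 0 <= z means z is real and non-negative *)
Definition nonneg_mx (A : 'M[C]_6) : Prop := forall i j, 0 <= A i j.

Definition isAutR (A : 'M[C]_6) : Prop := isAut A /\ real_mx A.

Definition proj_eq (A B : 'M[C]_6) : Prop := exists c : C, c != 0 /\ A = c *: B.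
Definition pos_eq (A B : 'M[C]_6) : Prop := exists c : C, 0 < c /\ A = c *: B.

End Defs.

Definition quot_card (T : Type) (P : T -> Prop) (E : T -> T -> Prop) (n : nat)
  : Prop :=
  exists f : 'I_n -> T,
    (forall i, P (f i)) /\
    (forall i j, E (f i) (f j) -> i = j) /\
    (forall x, P x -> exists i, E x (f i)).

(* Weyl group of type D_6: the group of 6x6 rational matrices generated by the
   reflections s_a (x |-> x - 2 (a.x)/(a.a) a = x - (a.x) a) in the roots
   a = +-e_i +- e_j (i <> j) of D_6 (row-vector convention). *)
Definition D6root (a : 'rV[rat]_6) : Prop :=
  exists (i j : 'I_6) (si sj : bool), i != j /\
    a = (-1) ^+ si *: delta_mx 0 i + (-1) ^+ sj *: delta_mx 0 j.

Definition reflD6 (a : 'rV[rat]_6) : 'M[rat]_6 := 1%:M - a^T *m a.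

Definition WD6 (W : 'M[rat]_6) : Prop :=
  exists s : seq 'rV[rat]_6, (forall a, a \in s -> D6root a) /\
    W = foldr (fun a M => reflD6 a *m M) 1%:M s.

Definition edge_perm_mx (R : realType) (sigma : 'S_4) : 'M[R[i]]_6 :=
  \matrix_(e < 6, f < 6)
    (((sigma (edge f).1 == (edge e).1) && (sigma (edge f).2 == (edge e).2)) ||
     ((sigma (edge f).1 == (edge e).2) && (sigma (edge f).2 == (edge e).1)))%:R.

(* Main.v *)
Require Import Defs.
From mathcomp Require Import all_boot all_order all_algebra.
From mathcomp Require Import perm reals complex.
From mathcomp Require Import boolp separable ring.
Import Order.TTheory GRing.Theory Num.Theory.
Local Open Scope ring_scope.
Local Open Scope complex_scope.

Set Implicit Arguments.
Unset Strict Implicit.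
Unset Printing Implicit Defensive.

(* In the coordinates y_e = x_e + x_e', y_e' = x_e - x_e' attached to the three pairs
   {e, e'} of opposite edges, L_{2,4} is the zero set of the sextic
     p_2^3 - 6 p_2 p_4 + 8 p_6 - 48 y_1 ... y_6,   p_m = sum_i y_i^m,
   which is visibly invariant under the even signed permutations, i.e. under W(D_6).
   Conversely, let B be linear and invertible and map the zero set to itself. A line
   meeting it in six distinct points determines the sextic up to a scalar along that
   line, so B preserves the sextic up to a scalar, hence also its triple points. At a
   triple point the pure second derivatives vanish, which forces all y_i^2 to be equal,
   and the vectors of signs with product 1 are triple points. So for every such vector e
   the square of (B e)_m does not depend on m; as the products e_i e_j are linearly
   independent functions of e, the products B_mi B_mj (i <> j) do not depend on m
   either. If one of them were nonzero, B would have rank at most 2; hence B is a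
   multiple of a signed permutation, even because the sextic does not vanish at odd
   vectors of signs. A real automorphism is thus a positive multiple of an orthogonal
   matrix; if it is also non-negative it is a multiple of a permutation matrix, and
   looking at which 0/1 vectors lie in L_{2,4} shows that this permutation of the edges
   preserves opposite edges and stars. *)

(** * The invariant sextic *)

Definition sextic (K : comNzRingType) (y : 'I_6 -> K) : K :=
  (\sum_i y i ^+ 2) ^+ 3 - 6 * ((\sum_i y i ^+ 2) * (\sum_i y i ^+ 4))
    + 8 * (\sum_i y i ^+ 6) - 48 * \prod_i y i.

Lemma eq_sextic (K : comNzRingType) (y z : 'I_6 -> K) :
  y =1 z -> sextic y = sextic z.
Proof.
by move=> yz; rewrite /sextic; congr (_ ^+ 3 - 6 * (_ * _) + 8 * _ - 48 * _);
  apply: eq_bigr => i _; rewrite yz.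
Qed.

Lemma rmorph_sextic (K K' : comNzRingType) (f : {rmorphism K -> K'}) y :
  f (sextic y) = sextic (f \o y).
Proof.
rewrite /sextic rmorphB rmorphD rmorphB rmorphXn !(rmorphM f _%:R) rmorphM !rmorph_nat.
rewrite !rmorph_sum rmorph_prod /=.
by congr (_ ^+ 3 - 6 * (_ * _) + 8 * _ - 48 * _); apply: eq_bigr => i _;
  rewrite ?rmorphXn.
Qed.

Lemma sexticZ (K : comNzRingType) (k : K) y :
  sextic (fun i => k * y i) = k ^+ 6 * sextic y.
Proof.
rewrite /sextic.
have sumX m : \sum_i (k * y i) ^+ m = k ^+ m * \sum_i y i ^+ m.
  by rewrite mulr_sumr; apply: eq_bigr => i _; rewrite exprMn.
rewrite !sumX big_split /= prodr_const card_ord.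
by ring.
Qed.

Lemma sextic_perm (K : comNzRingType) (y : 'I_6 -> K) (s : 'S_6) :
  sextic (y \o s) = sextic y.
Proof.
rewrite /sextic.
congr (_ ^+ 3 - 6 * (_ * _) + 8 * _ - 48 * _);
  by rewrite [RHS](reindex_inj (@perm_inj _ s)).
Qed.

Lemma sextic_sign (K : comNzRingType) (e y : 'I_6 -> K) :
    (forall i, e i ^+ 2 = 1) -> \prod_i e i = 1 ->
  sextic (fun i => e i * y i) = sextic y.
Proof.
move=> e2 pe; rewrite /sextic big_split /= pe mul1r.
have e2m m i : e i ^+ (2 * m)%N = 1 by rewrite exprM e2 expr1n.
congr (_ ^+ 3 - 6 * (_ * _) + 8 * _ - _); apply: eq_bigr => i _;
  by rewrite exprMn ?(e2m 1%N) ?(e2m 2%N) ?(e2m 3%N) mul1r.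
Qed.

(** The ring is arbitrary so that this also applies over a polynomial ring, where one line becomes a
    pencil of lines. *)
Definition line_sextic (K : comNzRingType) (x u : 'cV[K]_6) : {poly K} :=
  sextic (fun i => (x i 0)%:P + (u i 0)%:P * 'X).

Definition vsextic (K : comNzRingType) (x : 'cV[K]_6) := sextic (x^~ 0).

Lemma horner_line_sextic (K : comNzRingType) (x u : 'cV[K]_6) t :
  (line_sextic x u).[t] = vsextic (x + t *: u).
Proof.
rewrite -[LHS]/(horner_eval t _) /line_sextic rmorph_sextic.
apply: eq_sextic => i /=; rewrite /horner_eval !mxE !hornerE; ring.
Qed.

(** * Degree bounds with a prescribed top coefficient *)

Section TopCoef.
Variable K : comNzRingType.

(** [c] may be zero, so [d] only bounds the degree; sums then need no discussion of cancellation. *)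
Definition has_top d (p : {poly K}) (c : K) := (size p <= d.+1)%N /\ p`_d = c.

Lemma has_topM d d' p p' c c' :
  has_top d p c -> has_top d' p' c' -> has_top (d + d') (p * p') (c * c').
Proof.
move=> [sp <-] [sp' <-]; split.
  by apply: (leq_trans (size_polyMleq _ _));
    rewrite -subn1 leq_subLR add1n -addnS -addSn leq_add.
rewrite coefM (bigD1 (inord d)) //= inordK ?ltnS ?leq_addr // addKn.
rewrite big1 ?addr0 // => j; rewrite -val_eqE /= inordK ?ltnS ?leq_addr // => jd.
have [dj|jd'] := ltnP d j; first by rewrite nth_default ?mul0r // (leq_trans sp).
rewrite [X in _ * X]nth_default ?mulr0 // (leq_trans sp') //.
by rewrite ltn_subRL ltn_add2r ltn_neqAle jd.
Qed.

Lemma has_topD d p p' c c' :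
  has_top d p c -> has_top d p' c' -> has_top d (p + p') (c + c').
Proof.
move=> [sp <-] [sp' <-]; split; last by rewrite coefD.
by rewrite (leq_trans (size_polyD _ _)) // geq_max sp.
Qed.

Lemma has_topN d p c : has_top d p c -> has_top d (- p) (- c).
Proof. by move=> [sp <-]; split; rewrite ?size_polyN ?coefN. Qed.

Lemma has_topMn d p c n : has_top d p c -> has_top d (n%:R * p) (n%:R * c).
Proof.
move=> pc; have n0 : has_top 0 (n%:R : {poly K}) n%:R.
  by rewrite -polyC_natr; split; rewrite ?size_polyC_leq1 // coefC.
exact: has_topM n0 pc.
Qed.

Lemma has_topX d p c m : has_top d p c -> has_top (m * d) (p ^+ m) (c ^+ m).
Proof.
move=> pc; elim: m => [|m IHm]; last by rewrite mulSn !exprS; apply: has_topM.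
by split; rewrite ?size_poly1 // mul0n !expr0 coef1.
Qed.

Lemma has_top_sum d (I : finType) (p : I -> {poly K}) c :
  (forall i, has_top d (p i) (c i)) -> has_top d (\sum_i p i) (\sum_i c i).
Proof.
move=> pc; apply: (big_ind2 (has_top d)) => // [|p1 c1 p2 c2]; last exact: has_topD.
by split; rewrite ?size_poly0 // coef0.
Qed.

Lemma has_top_prod d n (p : 'I_n -> {poly K}) c :
  (forall i, has_top d (p i) (c i)) ->
  has_top (n * d) (\prod_i p i) (\prod_i c i).
Proof.
elim: n p c => [|n IHn] p c pc.
  by rewrite !big_ord0 mul0n; split; rewrite ?size_poly1 // coef1.
by rewrite !big_ord_recl mulSn; apply: has_topM => //; apply: IHn => i.
Qed.

End TopCoef.


(** By homogeneity of degree six, the top coefficient along a line is the value at its direction. *)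
Lemma has_top_line_sextic (K : comNzRingType) (x u : 'cV[K]_6) :
  has_top 6 (line_sextic x u) (vsextic u).
Proof.
have lin i : has_top 1 ((x i 0)%:P + (u i 0)%:P * 'X) (u i 0).
  split; last by rewrite coefD coefC coefCM coefX add0r mulr1.
  by rewrite addrC size_MXaddC; case: ifP => // _; rewrite ltnS size_polyC_leq1.
have linX m : has_top m (\sum_i ((x i 0)%:P + (u i 0)%:P * 'X) ^+ m)
                        (\sum_i u i 0 ^+ m).
  by apply: has_top_sum => i; rewrite -[m in has_top m]muln1; apply: has_topX.
apply: has_topD; last by apply/has_topN/has_topMn/(has_top_prod (d := 1)).
apply: has_topD; last exact: has_topMn.
apply: has_topD; first exact: (has_topX (d := 2) 3).
exact/has_topN/has_topMn/(has_topM (d := 2) (d' := 4)).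
Qed.

Lemma poly_horner_eq0 (K : numDomainType) (p : {poly K}) :
  (forall t, p.[t] = 0) -> p = 0.
Proof.
move=> p0; apply/eqP/negPn/negP => nz_p.
(* In characteristic zero these are [size p] distinct roots, one too many. *)
pose rs : seq K := [seq i%:R | i <- iota 0 (size p)].
suff : (size rs < size p)%N by rewrite size_map size_iota ltnn.
apply: max_poly_roots => //; first by apply/allP => t _; rewrite /root p0.
by rewrite map_inj_uniq ?iota_uniq // => m n /eqP; rewrite eqr_nat => /eqP.
Qed.

Lemma has_top_size (K : comNzRingType) d (p : {poly K}) c :
  has_top d p c -> c != 0 -> size p = d.+1.
Proof.
move=> [sp pc] nz_c; apply/eqP; rewrite eqn_leq sp ltnNge; apply/negP => sp'.
by move: nz_c; rewrite -pc nth_default ?eqxx.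
Qed.

Lemma has_top_lead (K : comNzRingType) d (p : {poly K}) c :
  has_top d p c -> c != 0 -> lead_coef p = c.
Proof. by move=> pc nz_c; rewrite lead_coefE (has_top_size pc nz_c) (proj2 pc). Qed.

Lemma has_top_deriv (K : comNzRingType) d (p : {poly K}) c :
  has_top d.+1 p c -> has_top d p^`() (c *+ d.+1).
Proof.
move=> [sp <-]; split; last by rewrite coef_deriv.
have [->|nz_p] := eqVneq p 0; first by rewrite deriv0 size_poly0.
by have := lt_size_deriv nz_p => /leq_trans/(_ sp).
Qed.

(** * Linear maps preserving the zero set of the sextic *)

Section Proportional.
Variable K : numClosedFieldType.

Lemma separable_roots (p : {poly K}) :
  coprimep p p^`() -> {r : seq K | uniq r & p = lead_coef p *: \prod_(z <- r) ('X - z%:P)}.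
Proof.
move=> cop; have [r def_p] := closed_field_poly_normal p; exists r => //.
have [lc0|nz_lc] := eqVneq (lead_coef p) 0.
  by move: cop; rewrite def_p lc0 scale0r deriv0 coprimep0 -size_poly_eq1 size_poly0.
rewrite -separable_prod_XsubC unlock.
move: cop; rewrite def_p derivZ.
by rewrite coprimepZl // coprimepZr.
Qed.

(* Nonvanishing of the resultant shows that almost all lines in a pencil of parallel
   lines meet the zero set in six distinct points as soon as one of them does. *)
Lemma vsextic_proportional (B : 'M[K]_6) :
    (forall x : 'cV_6, vsextic x = 0 -> vsextic (B *m x) = 0) ->
  exists c, forall x : 'cV_6, vsextic (B *m x) = c * vsextic x.
Proof.
move=> BL.
(* The sextic is 3 at [v], so on every line parallel to [v] it has degree exactly six. On the line
   through [x0] it is 3 (t^4 - 9) (t^2 - 5), which has six simple roots. *)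
pose v : 'cV[K]_6 := delta_mx 0 0.
pose x0 : 'cV[K]_6 := delta_mx 1 0 + 2 *: delta_mx 2 0.
have Qv : vsextic v = 3.
  rewrite /vsextic /sextic !big_ord_recl !big_ord0 !mxE /=; ring.
have nz3 : (3 : K) != 0 by rewrite pnatr_eq0.
have line_v (x : 'cV[K]_6) : has_top 6 (line_sextic x v) 3.
  by rewrite -Qv; apply: has_top_line_sextic.
exists (vsextic (B *m v) / 3) => x.
have [d ->] : exists d, x = x0 + d by exists (x - x0); rewrite addrC subrK.
(* The lines through x0 + s d parallel to [v], with coefficients polynomial in s; [r] below is their
   discriminant up to a scalar factor. *)
pose P : {poly {poly K}} :=
  line_sextic (\col_i ((x0 i 0)%:P + (d i 0)%:P * 'X)) (\col_i (v i 0)%:P).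
have P_top : has_top 6 P 3%:R.
  have -> : 3%:R = vsextic (\col_i (v i 0)%:P).
    rewrite -polyC_natr -[3%:R]Qv /vsextic rmorph_sextic.
    by apply: eq_sextic => i /=; rewrite !mxE.
  exact: has_top_line_sextic.
have mapP s : map_poly (horner_eval s) P = line_sextic (x0 + s *: d) v.
  rewrite /P /line_sextic rmorph_sextic; apply: eq_sextic => i /=.
  rewrite !mxE rmorphD rmorphM /= map_polyX !map_polyC /= /horner_eval !hornerE.
  by rewrite [d i 0 * s]mulrC.
have nz3P : (3%:R : {poly K}) != 0 by rewrite -polyC_natr polyC_eq0.
have nz18P : (3%:R *+ 6 : {poly K}) != 0.
  by rewrite -mulrnA -polyC_natr polyC_eq0 pnatr_eq0.
pose r := resultant P P^`().
have r_s s : r.[s] = resultant (line_sextic (x0 + s *: d) v)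
                               (line_sextic (x0 + s *: d) v)^`().
  rewrite -mapP deriv_map -[LHS]/(horner_eval s r); apply: map_resultant => /=.
    by rewrite (has_top_lead P_top) // rmorph_nat.
  rewrite (has_top_lead (has_top_deriv P_top)) // rmorphMn rmorph_nat -mulrnA.
  by rewrite pnatr_eq0.
have nz_r : r != 0.
  apply: contraTneq (isT : true) => r0; have := r_s 0.
  rewrite r0 horner0 => /esym/eqP; rewrite resultant_eq0 scale0r addr0.
  have -> : line_sextic x0 v = 3%:R * ('X^6 - 5%:R * 'X^4 - 9%:R * 'X^2 + 45%:R).
    rewrite /line_sextic /sextic !big_ord_recl !big_ord0 !mxE /=.
    rewrite !(mulr0, mulr1, addr0, add0r, polyC0, mul0r, polyC1, mul1r, polyC_natr).
    by ring.
  suff /eqP -> : coprimep (3%:R * ('X^6 - 5%:R * 'X^4 - 9%:R * 'X^2 + 45%:R) : {poly K})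
     (3%:R * ('X^6 - 5%:R * 'X^4 - 9%:R * 'X^2 + 45%:R))^`() by [].
  apply/Pdiv.ClosedField.coprimepP => t; rewrite /root -!polyC_natr !derivE !hornerE.
  rewrite mulf_eq0 (negPf nz3) /= => Pt.
  have {}Pt : (t ^+ 4 - 9) * (t ^+ 2 - 5) == 0 by rewrite -(eqP Pt); apply/eqP; ring.
  rewrite mulf_eq0 (negPf nz3) /=; apply/negP => /eqP Pt'.
  (* Up to the factor 3 the derivative is 6 t^5 - 20 t^3 - 18 t. If t^4 = 9 it equals 4 t (9 - 5
     t^2), and multiplying by 9 + 5 t^2 gives - 576 t; if t^2 = 5 it equals 32 t. So a double root
     could only be 0, which is not a root. *)
  suff t0 : t = 0.
    by move: Pt; rewrite t0 !expr0n /= !sub0r mulrNN -natrM pnatr_eq0.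
  move: Pt; rewrite mulf_eq0 !subr_eq0 => /orP[] /eqP tX; apply/eqP.
    have : t * 576 == 0.
      apply/eqP; rewrite [RHS](_ : _ = - (0 * (9 + 5 * t ^+ 2))); last by ring.
      rewrite -Pt'; ring: tX.
    by rewrite mulf_eq0 pnatr_eq0 orbF.
  have : t * 32 == 0 by apply/eqP; rewrite -[RHS]Pt'; ring: tX.
  by rewrite mulf_eq0 pnatr_eq0 orbF.
pose c := vsextic (B *m v) / 3; rewrite -/c.
(* [D] at 1 is the claim for x0 + d. As [r] is a nonzero polynomial, it suffices that [D] vanishes
   wherever [r] does not. *)
pose D := line_sextic (B *m x0) (B *m d) - c%:P * line_sextic x0 d.
suff D0 : D = 0.
  have := congr1 (horner^~ 1) D0.
  rewrite /D horner0 hornerD hornerN hornerM hornerC !horner_line_sextic !scale1r -mulmxDr.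
  by move/eqP; rewrite subr_eq0 => /eqP.
suff /eqP : r * D = 0 by rewrite mulf_eq0 (negPf nz_r) => /eqP.
apply: poly_horner_eq0 => s; rewrite hornerM.
have [->|] := eqVneq r.[s] 0; first by rewrite mul0r.
set y := x0 + s *: d.
rewrite r_s resultant_eq0 -/y => cop.
have Py := line_v y.
have {cop} /separable_roots [rs uniq_rs def_P] :
    coprimep (line_sextic y v) (line_sextic y v)^`().
  rewrite /coprimep eqn_leq leqNgt cop size_poly_gt0 gcdp_eq0 -size_poly_eq0.
  by rewrite (has_top_size Py).
have size_rs : size rs = 6%N.
  have := has_top_size Py nz3; rewrite def_P size_scale ?(has_top_lead Py) //.
  by rewrite size_prod_XsubC => -[].
(* By the choice of [c] the terms of degree six cancel, yet [E] vanishes at the six points of [rs].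
   Its value at 0 is that of [D] at s. *)
pose E := line_sextic (B *m y) (B *m v) - c%:P * line_sextic y v.
have E_top : has_top 6 E 0.
  have -> : 0 = vsextic (B *m v) - c * 3 by rewrite divfK ?subrr.
  apply: has_topD; first exact: has_top_line_sextic.
  apply/has_topN/(has_topM (d := 0)) => //.
  by split; rewrite ?size_polyC_leq1 // coefC.
have E0 : E = 0.
  apply/eqP/negPn/negP => nz_E.
  suff : (size rs < size E)%N.
    rewrite size_rs => sE; have {}sE : size E = 7%N.
      by apply/eqP; rewrite eqn_leq (proj1 E_top).
    by move: nz_E; rewrite -lead_coef_eq0 lead_coefE sE (proj2 E_top) eqxx.
  apply: max_poly_roots => //; apply/allP => z z_rs.
  have Pz : vsextic (y + z *: v) = 0.
    apply/eqP; rewrite -horner_line_sextic def_P hornerZ mulf_eq0.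
    by rewrite -[_.[z] == 0]/(root _ z) root_prod_XsubC z_rs orbT.
  rewrite /root /E hornerD hornerN hornerM hornerC !horner_line_sextic Pz mulr0 subr0.
  by rewrite scalemxAr -mulmxDr BL.
have := congr1 (horner^~ 0) E0.
rewrite /E horner0 hornerD hornerN hornerM hornerC !horner_line_sextic !scale0r !addr0.
rewrite /D hornerD hornerN hornerM hornerC !horner_line_sextic scalemxAr -mulmxDr -/y.
by move=> ->; rewrite mulr0.
Qed.
End Proportional.

(** * Triple points of the sextic *)

(** Multiplicity at least three, tested on all lines through the point, a form that linear maps
    transport directly. *)
Definition triple_point (K : comNzRingType) (x : 'cV[K]_6) :=
  forall u : 'cV[K]_6, exists q, line_sextic x u = 'X^3 * q.

(** A line through [B *m x] is the image of the line through [x] whose direction is pulled back by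
    [B]. *)
Lemma triple_point_mulmx (K : numFieldType) (B : 'M[K]_6) c x :
    B \in unitmx -> (forall y : 'cV_6, vsextic (B *m y) = c * vsextic y) ->
  triple_point x -> triple_point (B *m x).
Proof.
move=> uB Bc trx u; have [q def_q] := trx (invmx B *m u).
exists (c%:P * q); rewrite mulrCA -def_q; apply/eqP; rewrite -subr_eq0; apply/eqP.
apply: poly_horner_eq0 => t.
rewrite hornerD hornerN hornerM hornerC !horner_line_sextic.
by rewrite -Bc mulmxDr -scalemxAr mulKVmx // subrr.
Qed.

(** The quadratic coefficient along the i-th axis gives 24 x_i^4 - 8 p_2 x_i^2 + p_2^2 - 2 p_4 = 0.
    Summing over i yields 6 p_4 = p_2^2, and the equation becomes 24 (x_i^2 - p_2/6)^2 = 0. *)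
Lemma triple_point_sqr (K : numFieldType) (x : 'cV[K]_6) :
  triple_point x -> forall i, x i 0 ^+ 2 = (\sum_j x j 0 ^+ 2) / 6.
Proof.
move=> trx.
pose p m := \sum_j x j 0 ^+ m.
have eq_i i : 24 * x i 0 ^+ 4 - 8 * p 2 * x i 0 ^+ 2 + p 2 ^+ 2 - 2 * p 4 = 0.
  have [q] := trx (delta_mx i 0); rewrite /line_sextic /sextic.
  pose S m := \sum_(j | j != i) x j 0 ^+ m.
  pose E := \prod_(j | j != i) x j 0.
  set a := x i 0.
  have pS m : p m = a ^+ m + S m by rewrite /p (bigD1 i).
  have sumX m : \sum_j ((x j 0)%:P + ((delta_mx i 0 : 'cV[K]_6) j 0)%:P * 'X) ^+ m
      = (a%:P + 'X) ^+ m + (S m)%:P.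
    rewrite (bigD1 i) //= mxE !eqxx mul1r; congr (_ + _).
    rewrite raddf_sum /=; apply: eq_bigr => j /negPf ji.
    by rewrite mxE ji mul0r addr0 polyC_exp.
  have prodX : \prod_j ((x j 0)%:P + ((delta_mx i 0 : 'cV[K]_6) j 0)%:P * 'X)
      = (a%:P + 'X) * E%:P.
    rewrite (bigD1 i) //= mxE !eqxx mul1r; congr (_ * _).
    rewrite rmorph_prod /=; apply: eq_bigr => j /negPf ji.
    by rewrite mxE ji mul0r addr0.
  rewrite !sumX prodX => eq_q.
  (* Taylor coefficients in the direction of the i-th axis; [r] collects the terms of degree three
     to six. *)
  pose c0 := p 2 ^+ 3 - 6 * p 2 * p 4 + 8 * p 6 - 48 * a * E.
  pose c1 := 6 * a * p 2 ^+ 2 - 6 * (p 2 * 4 * a ^+ 3 + 2 * a * p 4) + 48 * a ^+ 5 - 48 * E.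
  pose c2 := 3 * (24 * a ^+ 4 - 8 * p 2 * a ^+ 2 + p 2 ^+ 2 - 2 * p 4).
  pose r : {poly K} := (72 * a ^+ 3 - 12 * a * p 2)%:P + (48 * a ^+ 2 - 3 * p 2)%:P * 'X
       + (18 * a)%:P * 'X^2 + 3%:P * 'X^3.
  have : 'X^3 * q = c0%:P + c1%:P * 'X + c2%:P * 'X^2 + 'X^3 * r.
    rewrite -eq_q /c0 /c1 /c2 /r !pS; ring.
  move/(congr1 (fun f : {poly K} => f`_2)).
  rewrite !coefD !coefXnM !coefCM coefC coefX coefXn /= mulr0 mulr1 !add0r addr0.
  move/esym/eqP; rewrite mulf_eq0 pnatr_eq0 /= => /eqP <-; ring.
have p24 : 6 * p 4 = p 2 ^+ 2.
  have : \sum_i (24 * x i 0 ^+ 4 - 8 * p 2 * x i 0 ^+ 2 + p 2 ^+ 2 - 2 * p 4) = 0.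
    by rewrite big1.
  rewrite !(big_split, sumrN) /= -!mulr_sumr -/(p 4) -/(p 2) !sumr_const card_ord => eq0.
  apply/eqP; rewrite -subr_eq0; apply/eqP.
  have : 2 * (6 * p 4 - p 2 ^+ 2) = 0 by rewrite -[RHS]eq0; ring.
  by move/eqP; rewrite mulf_eq0 pnatr_eq0 => /eqP.
move=> i; rewrite -/(p 2); apply/eqP; rewrite -subr_eq0 -sqrf_eq0.
have : 144 * (x i 0 ^+ 2 - p 2 / 6) ^+ 2 = 0.
  by rewrite -[RHS](mulr0 6) -[in RHS](eq_i i); move: (esym p24) => p42; field: p42.
by move/eqP; rewrite mulf_eq0 pnatr_eq0.
Qed.

(** [e2] is the second elementary symmetric function, tied to the power sums by Newton's identity;
    [e3] gathers all higher terms and may involve [t]. *)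
Lemma prod1D_expand (K : comNzRingType) n (w : 'I_n -> K) (t : K) :
  exists e2 e3, \prod_i (1 + w i * t) = 1 + t * \sum_i w i + t ^+ 2 * e2 + t ^+ 3 * e3
    /\ (\sum_i w i) ^+ 2 = \sum_i w i ^+ 2 + 2 * e2.
Proof.
elim: n w => [|n IHn] w.
  by exists 0, 0; rewrite !big_ord0; split; ring.
have [e2 [e3 [prodE sqrE]]] := IHn (fun i => w (lift ord0 i)).
rewrite !big_ord_recl /= prodE.
set s := \sum_(i < n) _ in prodE sqrE *; set s2 := \sum_(i < n) _ in sqrE *.
exists (e2 + w ord0 * s), (e3 + w ord0 * e2 + w ord0 * t * e3).
by split; [ring | ring: sqrE].
Qed.

(** Invariance under even sign changes moves the point to the all-ones vector, where the expansion
    is explicit. *)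
Lemma triple_point_sign (K : comNzRingType) (x : 'cV[K]_6) :
  (forall i, x i 0 ^+ 2 = 1) -> \prod_i x i 0 = 1 -> triple_point x.
Proof.
move=> x2 px u; rewrite /line_sextic.
pose w i := (x i 0 * u i 0)%:P.
rewrite (eq_sextic (z := fun i => (x i 0)%:P * (1 + w i * 'X))); last first.
  by move=> i; rewrite mulrDr mulr1 /w mulrA -polyCM mulrA -expr2 x2 mul1r.
rewrite sextic_sign; last 2 first.
- by move=> i; rewrite -polyC_exp x2.
- by rewrite -rmorph_prod px.
pose s m := \sum_i w i ^+ m.
have [e2 [e3 [prodE]]] := prod1D_expand w 'X.
rewrite -/(s 2) (_ : \sum_i w i = s 1) => [s12|]; last first.
  by apply: eq_bigr => i _; rewrite expr1.
rewrite /sextic prodE; rewrite (_ : \sum_i w i = s 1); last first.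
  by apply: eq_bigr => i _; rewrite expr1.
have -> : \sum_i (1 + w i * 'X) ^+ 2 = 6 + 2 * 'X * s 1 + 'X^2 * s 2.
  by rewrite /s !big_ord_recl !big_ord0; ring.
have -> : \sum_i (1 + w i * 'X) ^+ 4
    = 6 + 4 * 'X * s 1 + 6 * 'X^2 * s 2 + 4 * 'X^3 * s 3 + 'X^4 * s 4.
  by rewrite /s !big_ord_recl !big_ord0; ring.
have -> : \sum_i (1 + w i * 'X) ^+ 6
    = 6 + 6 * 'X * s 1 + 15 * 'X^2 * s 2 + 20 * 'X^3 * s 3 + 15 * 'X^4 * s 4
      + 6 * 'X^5 * s 5 + 'X^6 * s 6.
  by rewrite /s !big_ord_recl !big_ord0; ring.
(* The quotient by X^3: the constant and linear terms cancel, and the quadratic coefficient is 24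
   (s_1^2 - s_2 - 2 e_2), zero by [s12]. *)
exists ((2 * s 1 + 'X * s 2) ^+ 3 + 18 * (4 * s 1 * s 2 + 'X * s 2 ^+ 2)
  - 36 * (4 * s 3 + 'X * s 4)
  - 6 * (16 * s 1 * s 2 + 8 * 'X * s 1 * s 3 + 2 * 'X^2 * s 1 * s 4
         + 6 * 'X * s 2 ^+ 2 + 4 * 'X^2 * s 2 * s 3 + 'X^3 * s 2 * s 4)
  + 8 * (20 * s 3 + 15 * 'X * s 4 + 6 * 'X^2 * s 5 + 'X^3 * s 6) - 48 * e3).
ring: s12.
Qed.

(** * Matrices sending sign vectors to vectors with equal squares *)

(** For distinct [i] and [j], the sign vector with minus signs exactly there; these and the all-ones
    vector are the test vectors. *)
Definition flip2 (K : numFieldType) (i j : 'I_6) : 'cV[K]_6 :=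
  const_mx 1 - 2 *: (delta_mx i 0 + delta_mx j 0).

Section EqualSquares.
Variables (K : numFieldType) (B : 'M[K]_6).
Implicit Types (i j : 'I_6) (m n : 'I_6).

Let row_sum m := \sum_i B m i.

Lemma mulmx_ones m : (B *m const_mx 1 : 'cV_6) m 0 = row_sum m.
Proof. by rewrite mxE; apply: eq_bigr => i _; rewrite mxE mulr1. Qed.

Lemma mulmx_flip2 i j m : (B *m flip2 K i j) m 0 = row_sum m - 2 * (B m i + B m j).
Proof.
rewrite mulmxBr -scalemxAr mulmxDr -!colE -mulmx_ones.
by rewrite [LHS]mxE; congr (_ + _); rewrite !mxE.
Qed.

Hypothesis ones_sqr : forall m n,
  ((B *m const_mx 1 : 'cV_6) m 0) ^+ 2 = ((B *m const_mx 1 : 'cV_6) n 0) ^+ 2.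
Hypothesis flip2_sqr : forall i j, i != j ->
  forall m n, (B *m flip2 K i j) m 0 ^+ 2 = (B *m flip2 K i j) n 0 ^+ 2.

(** Let [del i j] be the difference of the two sides and [d i] its sum over j different from i. The
    test vectors give d_i + d_j = 2 del_ij. Summing over j gives 2 d_i = - D with D the sum of all
    d_i; summing again gives 8 D = 0, so every d_i and every del_ij vanishes. *)
Lemma row_products_eq m n i j : i != j -> B m i * B m j = B n i * B n j.
Proof.
move: i j.
pose del i j := B m i * B m j - B n i * B n j.
pose d i := \sum_j del i j - del i i.
have dE i : d i = B m i * row_sum m - B n i * row_sum n - del i i.
  by rewrite /d /del sumrB -!mulr_sumr.
have dD i j : i != j -> d i + d j = 2 * del i j.
  move=> ij; have := flip2_sqr ij m n; have := ones_sqr m n.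
  rewrite !mulmx_flip2 !mulmx_ones !dE /del => e1 /eqP; rewrite -subr_eq0 => /eqP e2.
  apply/eqP; rewrite -subr_eq0; apply/eqP.
  have : 4 * (B m i * row_sum m - B n i * row_sum n - (B m i * B m i - B n i * B n i)
     + (B m j * row_sum m - B n j * row_sum n - (B m j * B m j - B n j * B n j)) -
     2 * (B m i * B m j - B n i * B n j)) = 0.
    by rewrite -[RHS]oppr0 -[in RHS]e2; ring: e1.
  by move/eqP; rewrite mulf_eq0 pnatr_eq0 => /eqP.
pose D := \sum_j d j.
have d2 i : 2 * d i = - D.
  have : \sum_j (d i + d j) = 4 * d i.
    rewrite (bigD1 i) //= (eq_bigr (fun j => 2 * del i j)); last first.
      by move=> j ji; rewrite dD // eq_sym.
    rewrite -mulr_sumr (_ : \sum_(j | j != i) del i j = d i); first by ring.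
    by rewrite /d [in RHS](bigD1 i) //= addrAC subrr add0r.
  rewrite big_split /= sumr_const card_ord -/D => eqD.
  by apply/eqP; rewrite -addr_eq0 -(subrr (4 * d i)) -[X in _ == X - _]eqD; apply/eqP; ring.
have D0 : D = 0.
  have : 2 * D = - (6 * D).
    rewrite {1}/D mulr_sumr (eq_bigr (fun=> - D)) // sumr_const card_ord; ring.
  move/eqP; rewrite -addr_eq0 -mulrDl -natrD mulf_eq0 pnatr_eq0 => /eqP //.
have d0 i : d i = 0.
  by apply/eqP; have /eqP := d2 i; rewrite D0 oppr0 mulf_eq0 pnatr_eq0.
move=> i j ij; apply/eqP; rewrite -subr_eq0 -/(del i j).
by have /eqP := dD i j ij; rewrite !d0 addr0 eq_sym mulf_eq0 pnatr_eq0.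
Qed.

(** The squared row sum is common to all rows by the all-ones vector, and so are the mixed
    products. *)
Lemma row_norms_eq m n : \sum_i B m i ^+ 2 = \sum_i B n i ^+ 2.
Proof.
have sqr_sum k : \sum_i B k i ^+ 2 = row_sum k ^+ 2 - \sum_i \sum_(j | j != i) B k i * B k j.
  rewrite expr2 {1}/row_sum mulr_suml -sumrB; apply: eq_bigr => i _.
  by rewrite /row_sum (bigD1 i) //= mulrDr -mulr_sumr addrK.
rewrite !sqr_sum -!mulmx_ones (ones_sqr m n); congr (_ - _).
by apply: eq_bigr => i _; apply: eq_bigr => j ji; apply: row_products_eq; rewrite eq_sym.
Qed.

Hypothesis uB : B \in unitmx.

(* A nonzero product in columns [i], [j] would put all rows in the span of [e_i] and
   one further vector. *)
Lemma row_products_eq0 m i j : i != j -> B m i * B m j = 0.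
Proof.
move=> ij; apply/eqP/negPn/negP => nz_p.
have [k ki kj] : exists2 k : 'I_6, k != i & k != j.
  have : [set: 'I_6] != [set i; j].
    by apply: contraTneq (isT : (2 < 6)%N) => /(congr1 (fun A : {set 'I_6} => #|A|));
      rewrite cardsT card_ord cards2 ij.
  rewrite eq_sym -properT properE subsetT /= => /subsetPn[k _].
  by rewrite !inE negb_or => /andP[]; exists k.
pose p l := B m i * B m l.
(* A nonzero kernel vector: [B n i] is never zero, and it multiplies entry n of [B *m x] into p_k
   p_j - p_j p_k = 0. *)
pose x : 'cV[K]_6 := p k *: delta_mx j 0 - p j *: delta_mx k 0.
have Bx : B *m x = 0.
  apply/colP => n; rewrite mulmxBr -!scalemxAr -!colE !mxE.
  have nz_ni : B n i != 0.
    apply: contraNneq nz_p => ni0.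
    by rewrite (row_products_eq m n ij) ni0 mul0r.
  apply: (mulfI nz_ni); rewrite mulr0 mulrBr !(mulrCA (B n i)).
  rewrite -(row_products_eq m n ij) -(row_products_eq m n (_ : i != k)) 1?eq_sym //.
  by rewrite -/(p j) -/(p k) mulrC subrr.
have : x = 0 by rewrite -[x](mulKmx uB) Bx mulmx0.
move/colP/(_ k)/eqP; rewrite !mxE !eqxx (negPf kj) mulr0 sub0r mulr1 oppr_eq0.
by rewrite /p (negPf nz_p).
Qed.

(** Two distinct entries of a row have product zero and no column vanishes, so each row has exactly
    one nonzero entry; equal row norms make these entries equal up to sign. *)
Lemma monomial_of_equal_squares :
  exists (k : K) (e : {ffun 'I_6 -> bool}) (s : 'S_6),
    k != 0 /\ forall i j, B i j = k * ((-1) ^+ e i * (s i == j)%:R).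
Proof.
have col_nz j : exists m, B m j != 0.
  apply/existsP; apply: contraT; rewrite negb_exists => /forallP col0.
  suff /colP/(_ j)/eqP : (delta_mx j 0 : 'cV[K]_6) = 0 by rewrite !mxE !eqxx oner_eq0.
  rewrite -[LHS](mulKmx uB) -colE (_ : col j B = 0) ?mulmx0 //.
  by apply/colP => m; rewrite !mxE; apply/eqP/negPn/col0.
pose t j := xchoose (col_nz j).
have tP j : B (t j) j != 0 by apply: (xchooseP (col_nz j)).
have t_inj : injective t.
  move=> j j' tj; apply/eqP/negPn/negP => /(row_products_eq0 (t j))/eqP.
  by rewrite mulf_eq0 (negPf (tP j)) tj (negPf (tP j')).
pose s := (perm t_inj)^-1%g.
have sP i : B i (s i) != 0.
  by have := tP (s i); rewrite -[t _](permE t_inj) permKV.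
have s0 i j : s i != j -> B i j = 0.
  move=> /(row_products_eq0 i)/eqP; rewrite mulf_eq0 (negPf (sP i)) => /eqP //.
have normE i : \sum_j B i j ^+ 2 = B i (s i) ^+ 2.
  by rewrite (bigD1 (s i)) //= big1 ?addr0 // => j ji; rewrite s0 1?eq_sym // expr0n.
pose k := B 0 (s 0).
exists k, [ffun i => B i (s i) != k], s; split=> [|i j]; first exact: sP.
have [<-|sij] := eqVneq (s i) j; last by rewrite s0 // !mulr0.
rewrite ffunE mulr1; have /eqP := row_norms_eq i 0; rewrite !normE eqf_sqr -/k.
have [->|nk] /= := eqVneq (B i (s i)) k; first by rewrite mulr1.
by move/eqP->; rewrite mulrN1.
Qed.

End EqualSquares.

(** * Gram matrices of planar configurations *)

Section GramDecomposition.
Variable K : numClosedFieldType.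
Implicit Types a b c f g h : K.

(** The Gram matrix, for the bilinear form without conjugation, of three vectors in the plane. *)
Definition planar_gram a b c f g h := exists x1 y1 x2 y2 x3 y3 : K,
  [/\ x1 ^+ 2 + y1 ^+ 2 = a, x2 ^+ 2 + y2 ^+ 2 = b & x3 ^+ 2 + y3 ^+ 2 = c] /\
  [/\ x1 * x2 + y1 * y2 = f, x1 * x3 + y1 * y3 = g & x2 * x3 + y2 * y3 = h].

(** Determinant of the symmetric matrix with diagonal a, b, c and entries f, g, h in positions 12,
    13, 23. *)
Definition gram_det a b c f g h :=
  a * b * c + 2 * f * g * h - a * h ^+ 2 - b * g ^+ 2 - c * f ^+ 2.

Lemma rank1_sym2 a b c : a * c = b ^+ 2 ->
  exists u v : K, [/\ u ^+ 2 = a, u * v = b & v ^+ 2 = c].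
Proof.
move=> acb; have [a0|nz_a] := eqVneq a 0.
  move: acb; rewrite a0 mul0r => /esym/eqP; rewrite sqrf_eq0 => /eqP->.
  by exists 0, (sqrtC c); rewrite sqrtCK mul0r expr0n.
have nz_u : sqrtC a != 0 by rewrite sqrtC_eq0.
exists (sqrtC a), (b / sqrtC a); rewrite sqrtCK mulrC divfK // expr_div_n sqrtCK.
by split=> //; rewrite -acb mulrC mulKf.
Qed.

(** The first vector goes on the first axis. The Schur complement of [a] is then a symmetric 2 by 2
    matrix of determinant zero, which supplies the second coordinates. *)
Lemma gram_diag a b c f g h : a != 0 -> gram_det a b c f g h = 0 -> planar_gram a b c f g h.
Proof.
move=> nz_a det0.
have [|y2 [y3 [e1 e2 e3]]] := @rank1_sym2 (b - f ^+ 2 / a) (h - f * g / a) (c - g ^+ 2 / a).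
  apply: (mulfI nz_a); apply/eqP; rewrite -subr_eq0; apply/eqP.
  by rewrite -[RHS]det0 /gram_det; field.
have nz_r : sqrtC a != 0 by rewrite sqrtC_eq0.
have r2 := sqrtCK a.
exists (sqrtC a), 0, (f / sqrtC a), y2, (g / sqrtC a), y3.
rewrite !mul0r !addr0 expr0n addr0 !expr_div_n r2 e1 e3; split; split=> //.
- by rewrite addrC subrK.
- by rewrite addrC subrK.
- by rewrite mulrC divfK.
- by rewrite mulrC divfK.
- by rewrite e2 mulrACA -invfM -expr2 r2 addrC subrK.
Qed.

(** Two vectors lie on the isotropic line of (1, i), the third on that of (1, -i). *)
Lemma gram_isotropic g h : planar_gram 0 0 0 0 g h.
Proof.
have i2 := sqrCi K.
exists g, (g * 'i), h, (h * 'i), (1 / 2), (- 'i / 2).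
by split; split; field: i2.
Qed.

(** Reordering the vectors handles any nonzero diagonal entry. If the diagonal vanishes, the
    determinant is 2fgh, so an off-diagonal entry vanishes as well. *)
Lemma gram_planar a b c f g h : gram_det a b c f g h = 0 -> planar_gram a b c f g h.
Proof.
move=> det0.
have [a0|] := eqVneq a 0; last by move=> nz; apply: gram_diag.
have [b0|nz_b] := eqVneq b 0; last first.
  have [|x1 [y1 [x2 [y2 [x3 [y3 [[e1 e2 e3] [e4 e5 e6]]]]]]]] :=
      @gram_diag b a c f h g nz_b; first by rewrite -det0 /gram_det; ring.
  by exists x2, y2, x1, y1, x3, y3; split; split=> //; rewrite -e4; ring.
have [c0|nz_c] := eqVneq c 0; last first.
  have [|x1 [y1 [x2 [y2 [x3 [y3 [[e1 e2 e3] [e4 e5 e6]]]]]]]] :=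
      @gram_diag c b a h g f nz_c; first by rewrite -det0 /gram_det; ring.
  exists x3, y3, x2, y2, x1, y1; split; split=> //.
  - by rewrite -e6; ring.
  - by rewrite -e5; ring.
  - by rewrite -e4; ring.
move: det0; rewrite a0 b0 c0 /gram_det !mul0r !subr0 add0r => /eqP.
rewrite !mulf_eq0 pnatr_eq0 /= -orbA => /or3P[] /eqP ->.
- exact: gram_isotropic.
- have [x1 [y1 [x2 [y2 [x3 [y3 [[e1 e2 e3] [e4 e5 e6]]]]]]]] := gram_isotropic f h.
  by exists x1, y1, x3, y3, x2, y2; split; split=> //; rewrite -e6; ring.
- have [x1 [y1 [x2 [y2 [x3 [y3 [[e1 e2 e3] [e4 e5 e6]]]]]]]] := gram_isotropic f g.
  exists x3, y3, x1, y1, x2, y2; split; split=> //; first by rewrite -e5; ring.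
  by rewrite -e6; ring.
Qed.

End GramDecomposition.

(** * The equation of L_{2,4} *)

(** A copy of the edge order in natural numbers, on which finite checks compute. *)
Definition edge_seq : seq (nat * nat) :=
  [:: (0, 1); (0, 2); (0, 3); (1, 2); (1, 3); (2, 3)]%N.

Lemma edgeE (e : 'I_6) :
  ((edge e).1 = (nth (0, 1) edge_seq e).1 :> nat) *
  ((edge e).2 = (nth (0, 1) edge_seq e).2 :> nat).
Proof.
by case: e => [[|[|[|[|[|[|//]]]]]] lt6]; split; rewrite /= inordK.
Qed.

(** Four times the Gram determinant of the three edge vectors at vertex 0; f, g, h are twice their
    inner products, by polarisation. *)
Definition cayley_menger (K : comNzRingType) (z : nat -> K) : K :=
  let f := z 0%N + z 1%N - z 3%N in
  let g := z 0%N + z 2%N - z 4%N in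
  let h := z 1%N + z 2%N - z 5%N in
  4 * z 0%N * z 1%N * z 2%N + f * g * h - z 0%N * h ^+ 2 - z 1%N * g ^+ 2 - z 2%N * f ^+ 2.

Section Membership.
Variable R : realType.
Notation C := R[i].

Definition entry (x : 'cV[C]_6) (n : nat) : C := x (inord n) 0.

Lemma entryE (x : 'cV[C]_6) (e : 'I_6) : x e 0 = entry x e.
Proof. by rewrite /entry inord_val. Qed.

Definition config (s : seq (C * C)) : 'M[C]_(4, 2) :=
  \matrix_(i, k) (if k == 0 :> nat then (nth (0, 0) s i).1 else (nth (0, 0) s i).2).

Lemma mK4E (p : 'M[C]_(4, 2)) (e : 'I_6) : mK4 p e 0 =
  (p (edge e).1 0 - p (edge e).2 0) ^+ 2 + (p (edge e).1 1 - p (edge e).2 1) ^+ 2.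
Proof. by rewrite mxE big_ord_recl big_ord1; congr (_ + (p _ _ - p _ _) ^+ 2); apply: val_inj. Qed.

(** With vertex 0 at the origin, realising [z] means finding three plane vectors with the Gram
    matrix obtained from [z] by polarisation. *)
Lemma M24P (z : 'cV[C]_6) : M24 z <-> cayley_menger (entry z) = 0.
Proof.
split=> [[p ->]|cm0].
  rewrite /entry /cayley_menger !mK4E /edge !inordK //=; ring.
have [|x1 [y1 [x2 [y2 [x3 [y3 [[e1 e2 e3] [e4 e5 e6]]]]]]]] :=
    @gram_planar _ (entry z 0%N) (entry z 1%N) (entry z 2%N)
      ((entry z 0%N + entry z 1%N - entry z 3%N) / 2)
      ((entry z 0%N + entry z 2%N - entry z 4%N) / 2)
      ((entry z 1%N + entry z 2%N - entry z 5%N) / 2).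
  apply: (mulfI (_ : (4 : C) != 0)); first by rewrite pnatr_eq0.
  by rewrite mulr0 -[RHS]cm0 /gram_det /cayley_menger; field.
exists (config [:: (0, 0); (x1, y1); (x2, y2); (x3, y3)]); apply/colP => e.
rewrite mK4E !mxE !edgeE /= entryE.
have half f : f / 2 *+ 2 = f :> C by rewrite -mulr_natr divfK ?pnatr_eq0.
have z3 : entry z 3%N = entry z 0%N + entry z 1%N - (x1 * x2 + y1 * y2) *+ 2.
  by rewrite e4 half; ring.
have z4 : entry z 4%N = entry z 0%N + entry z 2%N - (x1 * x3 + y1 * y3) *+ 2.
  by rewrite e5 half; ring.
have z5 : entry z 5%N = entry z 1%N + entry z 2%N - (x2 * x3 + y2 * y3) *+ 2.
  by rewrite e6 half; ring.
case: e => [[|[|[|[|[|[|//]]]]]] lt6] /=; rewrite ?z3 ?z4 ?z5 -?e1 -?e2 -?e3; ring.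
Qed.

End Membership.

(* Opposite edges are [i] and [rev_ord i]. *)
Definition d6_coord (K : comNzRingType) : 'M[K]_6 :=
  \matrix_(i, j) ((-1) ^+ (2 < i)%N * (i == j)%:R + (rev_ord i == j)%:R).

Lemma d6_coord_mulv (K : comNzRingType) (x : 'cV[K]_6) i :
  (d6_coord K *m x) i 0 = (-1) ^+ (2 < i)%N * x i 0 + x (rev_ord i) 0.
Proof.
rewrite mxE (eq_bigr (fun j =>
  (-1) ^+ (2 < i)%N * ((i == j)%:R * x j 0) + (rev_ord i == j)%:R * x j 0)); last first.
  by move=> j _; rewrite mxE mulrDl mulrA.
have pick k : \sum_j (k == j)%:R * x j 0 = x k 0.
  rewrite (bigD1 k) //= eqxx mul1r big1 ?addr0 // => j jk.
  by rewrite eq_sym (negPf jk) mul0r.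
by rewrite big_split /= -mulr_sumr !pick.
Qed.

Lemma d6_coord_sqr (K : comNzRingType) : d6_coord K *m d6_coord K = 2%:M.
Proof.
apply/matrixP => i j; transitivity ((d6_coord K *m (d6_coord K *m delta_mx j (0 : 'I_1))) i 0).
  by rewrite mulmxA -colE [RHS]mxE.
rewrite !d6_coord_mulv rev_ordK mulrDr mulrA -signr_addb addbb !mxE andbT -mulr_natr.
by case: i => [[|[|[|[|[|[|//]]]]]] lt6] /=; ring.
Qed.

Lemma tr_d6_coord (K : comNzRingType) : (d6_coord K)^T = d6_coord K.
Proof.
apply/matrixP => i j; rewrite !mxE [j == i]eq_sym (can2_eq rev_ordK rev_ordK).
rewrite [rev_ord i == _]eq_sym.
by have [->|] := eqVneq i j; rewrite ?mulr0.
Qed.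

(** This identity, a direct expansion in six variables, exposes the hidden symmetry of the
    determinant in the edge lengths. *)
Lemma vsextic_d6_coord (K : comNzRingType) (x : 'cV[K]_6) :
  vsextic (d6_coord K *m x) = - 96 * cayley_menger (fun n => x (inord n) 0 ^+ 2).
Proof.
pose X n := x (inord n) 0.
have XE i : (d6_coord K *m x) i 0 = (-1) ^+ (2 < i)%N * X i + X (5 - i)%N.
  by rewrite d6_coord_mulv /X inord_val; congr (_ + x _ 0); apply: val_inj;
    rewrite /= inordK ?ltnS ?leq_subr.
rewrite /vsextic (eq_sextic XE) /sextic /cayley_menger -/(X 0%N) -/(X 1%N) -/(X 2%N).
rewrite -/(X 3%N) -/(X 4%N) -/(X 5%N) !big_ord_recl !big_ord0 /= !subSS !subn0.
by move: X {XE} => X; rewrite /bump /=; ring.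
Qed.

Lemma L24P (R : realType) (x : 'cV[R[i]]_6) :
  L24 x <-> vsextic (d6_coord _ *m x) = 0.
Proof.
rewrite /L24 M24P vsextic_d6_coord; split=> [cm0|/eqP].
  rewrite (_ : cayley_menger _ = 0) ?mulr0 // -[RHS]cm0; congr cayley_menger.
  by apply: funext => n; rewrite /entry /sq mxE.
rewrite mulf_eq0 oppr_eq0 pnatr_eq0 /= => /eqP cm0.
rewrite -[RHS]cm0; congr cayley_menger.
by apply: funext => n; rewrite /entry /sq mxE.
Qed.

(** * Even signed permutations and automorphisms *)

(* [(e, s)] stands for the linear map [x |-> (i |-> (-1)^(e i) x_(s i))]; the Weyl
   group of type D_6 consists of those with an even number of sign changes. *)
Definition sperm := ({ffun 'I_6 -> bool} * 'S_6)%type.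

Definition even_sperm (w : sperm) := ~~ \big[addb/false]_i w.1 i.

Definition mul_sperm (w w' : sperm) : sperm :=
  ([ffun i => w.1 i (+) w'.1 (w.2 i)], (w.2 * w'.2)%g).

Definition one_sperm : sperm := ([ffun=> false], 1%g).

Definition opp_sperm (w : sperm) : sperm := ([ffun i => ~~ w.1 i], w.2).

Definition spmx (K : comNzRingType) (w : sperm) : 'M[K]_6 :=
  \matrix_(i, j) ((-1) ^+ w.1 i * (w.2 i == j)%:R).

Lemma even_mul_sperm w w' :
  even_sperm w -> even_sperm w' -> even_sperm (mul_sperm w w').
Proof.
rewrite /even_sperm => ev ev'.
under eq_bigr do rewrite ffunE.
by rewrite big_split /= (reindex_inj (@perm_inj _ w.2)) in ev' *;
  rewrite (negPf ev) (negPf ev').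
Qed.

Lemma even_one_sperm : even_sperm one_sperm.
Proof. by rewrite /even_sperm big1 // => i _; rewrite ffunE. Qed.

(** Six signs change, an even number; hence -1 belongs to the group. *)
Lemma even_opp_sperm w : even_sperm (opp_sperm w) = even_sperm w.
Proof.
rewrite /even_sperm; congr (~~ _).
under eq_bigr do rewrite ffunE -addTb.
by rewrite big_split /= !big_ord_recl !big_ord0.
Qed.

Lemma prod_sign_sperm (K : comNzRingType) (w : sperm) :
  \prod_i (-1) ^+ w.1 i = (-1) ^+ (~~ even_sperm w) :> K.
Proof.
rewrite /even_sperm negbK; apply: (big_ind2 (fun (x : K) (b : bool) => x = (-1) ^+ b)) => //.
by move=> x b y c -> ->; rewrite signr_addb.
Qed.

Lemma spmx_mulv (K : comNzRingType) w (x : 'cV[K]_6) i :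
  (spmx K w *m x) i 0 = (-1) ^+ w.1 i * x (w.2 i) 0.
Proof.
rewrite mxE (bigD1 (w.2 i)) //= big1 ?addr0 => [|j ji]; rewrite mxE.
  by rewrite eqxx mulr1.
by rewrite eq_sym (negPf ji) mulr0 mul0r.
Qed.

Lemma spmxM (K : comNzRingType) w w' :
  spmx K w *m spmx K w' = spmx K (mul_sperm w w').
Proof.
apply/matrixP => i j; rewrite mxE (bigD1 (w.2 i)) //= big1 ?addr0 => [|k ki].
  by rewrite !mxE eqxx mulr1 ffunE signr_addb permM mulrA.
by rewrite mxE eq_sym (negPf ki) mulr0 mul0r.
Qed.

Lemma spmx1 (K : comNzRingType) : spmx K one_sperm = 1%:M.
Proof. by apply/matrixP => i j; rewrite !mxE ffunE perm1 mul1r. Qed.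

Lemma spmxN (K : comNzRingType) w : spmx K (opp_sperm w) = - spmx K w.
Proof. by apply/matrixP => i j; rewrite !mxE ffunE signrN mulNr. Qed.

Lemma spmx_tr (K : comNzRingType) w : spmx K w *m (spmx K w)^T = 1%:M.
Proof.
apply/matrixP => i j; rewrite mxE (bigD1 (w.2 i)) //= big1 ?addr0 => [|k ki].
  rewrite !mxE eqxx mulr1 (inj_eq perm_inj) [j == i]eq_sym.
  by have [->|] := eqVneq i j; rewrite ?mulr0 // mulr1 -signr_addb addbb.
by rewrite mxE eq_sym (negPf ki) mulr0 mul0r.
Qed.

Lemma vsextic_spmx (K : comNzRingType) w (x : 'cV[K]_6) :
  even_sperm w -> vsextic (spmx K w *m x) = vsextic x.
Proof.
move=> ev; rewrite /vsextic (eq_sextic (spmx_mulv w x)).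
rewrite -(sextic_perm (x^~ 0) w.2).
apply: (@sextic_sign _ (fun i => (-1) ^+ w.1 i) ((x^~ 0) \o w.2)).
  by move=> i; rewrite -exprM muln2 -addnn exprD -signr_addb addbb.
by rewrite prod_sign_sperm ev.
Qed.

Lemma vsexticZ (K : comNzRingType) k (x : 'cV[K]_6) :
  vsextic (k *: x) = k ^+ 6 * vsextic x.
Proof. by rewrite -[in RHS]sexticZ; apply: eq_sextic => i; rewrite mxE. Qed.

Lemma map_spmx (K K' : comNzRingType) (f : {rmorphism K -> K'}) w :
  map_mx f (spmx K w) = spmx K' w.
Proof. by apply/matrixP => i j; rewrite !mxE rmorphM rmorph_sign rmorph_nat. Qed.

Lemma spmx_eqZ (K : numDomainType) (c : K) w w' : spmx K w = c *: spmx K w' ->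
  w.2 = w'.2 /\ forall i, (-1) ^+ w.1 i = c * (-1) ^+ w'.1 i :> K.
Proof.
move=> eqw.
have eqs i : w.2 i = w'.2 i.
  apply/eqP; rewrite eq_sym; move/matrixP/(_ i (w.2 i))/eqP: eqw; rewrite !mxE eqxx mulr1.
  by have [//|_] := eqVneq (w'.2 i) (w.2 i); rewrite !mulr0 signr_eq0.
split=> [|i]; first exact/permP.
by move/matrixP/(_ i (w.2 i)): eqw; rewrite !mxE -eqs eqxx !mulr1.
Qed.

Lemma spmx_inj (K : numDomainType) : injective (spmx K).
Proof.
move=> w w' eqw; have /spmx_eqZ[] : spmx K w = 1 *: spmx K w' by rewrite scale1r.
case: w w' {eqw} => e s [e' s'] /= -> eqe; congr (_, _); apply/ffunP => i.
by have := eqe i; rewrite mul1r => /signr_inj.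
Qed.

(** * Signed permutations read in the edge coordinates *)

Section AutMx.
Variable K : numFieldType.
Local Notation T := (d6_coord K).

(** A conjugate of [spmx K w], since the inverse of [d6_coord] is half of itself. *)
Definition aut_mx w : 'M[K]_6 := 2^-1 *: (T *m spmx K w *m T).

Lemma aut_mxM w w' : aut_mx w *m aut_mx w' = aut_mx (mul_sperm w w').
Proof.
rewrite /aut_mx -scalemxAl -scalemxAr -spmxM; congr (_ *: _).
rewrite !mulmxA -(mulmxA _ T T) d6_coord_sqr mul_mx_scalar -!scalemxAl scalerA.
by rewrite mulVf ?pnatr_eq0 // scale1r.
Qed.

Lemma aut_mx1 : aut_mx one_sperm = 1%:M.
Proof.
by rewrite /aut_mx spmx1 mulmx1 d6_coord_sqr scale_scalar_mx mulVf ?pnatr_eq0.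
Qed.

Lemma aut_mx_tr w : aut_mx w *m (aut_mx w)^T = 1%:M.
Proof.
rewrite /aut_mx linearZ /= !trmx_mul tr_d6_coord -scalemxAl -scalemxAr -!mulmxA.
rewrite (mulmxA T T) d6_coord_sqr mul_scalar_mx -!scalemxAr (mulmxA (spmx K w)).
rewrite spmx_tr mul1mx d6_coord_sqr !scale_scalar_mx; congr (_%:M).
by field.
Qed.

Lemma aut_mx_unit w : aut_mx w \in unitmx.
Proof. by have [] := mulmx1_unit (aut_mx_tr w). Qed.

Lemma aut_mxN w : aut_mx (opp_sperm w) = - aut_mx w.
Proof. by rewrite /aut_mx spmxN mulmxN mulNmx scalerN. Qed.

Lemma d6_coord_conj B : 2^-1 *: (T *m (2^-1 *: (T *m B *m T)) *m T) = B.
Proof.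
rewrite -scalemxAr -scalemxAl scalerA !mulmxA d6_coord_sqr mul_scalar_mx.
rewrite -!scalemxAl -!mulmxA d6_coord_sqr mul_mx_scalar !scalerA.
by rewrite [X in X *: _](_ : _ = 1) ?scale1r //; field.
Qed.

Lemma aut_mx_eqZ c w w' : aut_mx w = c *: aut_mx w' -> spmx K w = c *: spmx K w'.
Proof.
move=> eqw; rewrite -[LHS]d6_coord_conj -/(aut_mx w) eqw.
rewrite -[in RHS](d6_coord_conj (spmx K w')) -/(aut_mx w').
by rewrite -scalemxAr -scalemxAl scalerA mulrC -scalerA.
Qed.

Lemma aut_mx_mulv w (x : 'cV[K]_6) : T *m (aut_mx w *m x) = spmx K w *m (T *m x).
Proof.
rewrite /aut_mx -scalemxAl -scalemxAr !mulmxA d6_coord_sqr mul_scalar_mx.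
by rewrite -!scalemxAl scalerA mulVf ?pnatr_eq0 // scale1r.
Qed.

End AutMx.


Lemma isAutP (R : realType) (A : 'M[R[i]]_6) :
  isAut A <-> exists (k : R[i]) (w : sperm), [/\ k != 0, even_sperm w & A = k *: aut_mx _ w].
Proof.
set T := d6_coord R[i].
split=> [[uA AL]|[k [w [nz_k ev_w ->]]]]; last first.
  have uA : k *: aut_mx R[i] w \in unitmx by rewrite unitmxZ ?unitfE ?aut_mx_unit.
  have AL x : L24 ((k *: aut_mx _ w) *m x) <-> L24 x.
    rewrite !L24P -scalemxAl -scalemxAr aut_mx_mulv vsexticZ vsextic_spmx //.
    split=> [/eqP|->]; last by rewrite mulr0.
    by rewrite mulf_eq0 expf_eq0 (negPf nz_k) => /eqP.
  split=> // y; split=> [Ly|[x [Lx ->]]]; last exact/AL.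
  exists (invmx (k *: aut_mx R[i] w) *m y); rewrite mulKVmx //; split=> //.
  by apply/AL; rewrite mulKVmx.
(* [B] is [A] in the coordinates where the equation is the sextic. *)
pose B := 2^-1 *: (T *m A *m T).
have AE : A = 2^-1 *: (T *m B *m T) by rewrite d6_coord_conj.
have uT : T \in unitmx.
  have : T *m (2^-1 *: T) = 1%:M.
    by rewrite -scalemxAr d6_coord_sqr scale_scalar_mx mulVf ?pnatr_eq0.
  by case/mulmx1_unit.
have uB : B \in unitmx.
  by rewrite unitmxZ ?unitfE ?invr_eq0 ?pnatr_eq0 // !unitmx_mul uT uA.
have [x|c Bc] := @vsextic_proportional _ B.
  pose y : 'cV[R[i]]_6 := 2^-1 *: (T *m x).
  have -> : vsextic x = vsextic (T *m y).
    rewrite -scalemxAr mulmxA d6_coord_sqr mul_scalar_mx scalerA mulVf ?pnatr_eq0 //.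
    by rewrite scale1r.
  move/L24P => Ly; have /L24P : L24 (A *m y) by apply/AL; exists y.
  by rewrite /B /y -!scalemxAr -scalemxAl -!mulmxA.
have tripleB (x : 'cV[R[i]]_6) : (forall i, x i 0 ^+ 2 = 1) -> \prod_i x i 0 = 1 ->
    forall m n, (B *m x) m 0 ^+ 2 = (B *m x) n 0 ^+ 2.
  move=> x2 px m n; have := triple_point_mulmx uB Bc (triple_point_sign x2 px).
  by move/triple_point_sqr => sq; rewrite !sq.
have [||//|k [e [s [nz_k Bks]]]] := @monomial_of_equal_squares _ B.
- by apply: tripleB => [i|]; rewrite ?big1 // => *; rewrite mxE ?expr1n.
- move=> i j ij; apply: tripleB => [l|].
    rewrite !mxE !andbT; have [->|_] := eqVneq l i; last first.
      by case: (l == j) => /=; ring.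
    by rewrite (negPf ij) /=; ring.
  rewrite (bigD1 i) // (bigD1 j) 1?eq_sym //= big1 => [|l /andP[li lj]].
    by rewrite !mxE !eqxx (negPf ij) eq_sym (negPf ij) /=; ring.
  by rewrite !mxE (negPf li) (negPf lj) /=; ring.
exists k, (e, s).
have BE : B = k *: spmx _ (e, s) by apply/matrixP => i j; rewrite Bks !mxE.
split=> //; last first.
  by rewrite AE BE /aut_mx -scalemxAr -scalemxAl scalerA mulrC -scalerA.
(* The sextic vanishes at the all-ones vector but equals 216 - 216 + 48 + 48 = 96 at an odd vector
   of signs. *)
apply: contraT => odd_w.
have ones0 : vsextic (const_mx 1 : 'cV[R[i]]_6) = 0.
  by rewrite /vsextic /sextic !big_ord_recl !big_ord0 !mxE; ring.
have := Bc (const_mx 1); rewrite ones0 mulr0 BE -scalemxAl vsexticZ => /eqP.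
rewrite mulf_eq0 expf_eq0 (negPf nz_k) /= => /eqP.
rewrite /vsextic (eq_sextic (spmx_mulv _ _)) /=.
rewrite (@eq_sextic _ _ (fun i => (-1) ^+ e i)); last by move=> i; rewrite mxE mulr1.
rewrite /sextic (prod_sign_sperm _ (e, s)) odd_w.
have sum6 m : \sum_i ((-1) ^+ e i) ^+ (2 * m)%N = 6 :> R[i].
  rewrite (eq_bigr (fun=> 1)) ?sumr_const ?card_ord // => i _.
  by rewrite exprM sqrr_sign expr1n.
rewrite (sum6 1%N) (sum6 2%N) (sum6 3%N) => /eqP.
rewrite [X in X == 0](_ : _ = 96%:R) ?pnatr_eq0 //; ring.
Qed.

(** * The Weyl group of type D_6 *)

(** The reflection in e_i + e_j if [b] holds, in e_i - e_j otherwise. *)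
Definition refl_sperm (b : bool) (i j : 'I_6) : sperm :=
  ([ffun k => b && ((k == i) || (k == j))], tperm i j).

Lemma even_refl_sperm b i j : i != j -> even_sperm (refl_sperm b i j).
Proof.
move=> ij; rewrite /even_sperm (bigD1 i) //= (bigD1 j) 1?eq_sym //= !ffunE !eqxx orbT /=.
rewrite big1 ?addbF ?andbT ?addbb // => k /andP[ki kj].
by rewrite ffunE (negPf ki) (negPf kj) andbF.
Qed.

Lemma reflD6E (si sj : bool) i j : i != j ->
  reflD6 ((-1) ^+ si *: delta_mx 0 i + (-1) ^+ sj *: delta_mx 0 j) =
  spmx rat (refl_sperm (~~ (si (+) sj)) i j).
Proof.
move=> ij; apply/matrixP => k l; rewrite !mxE big_ord1 !mxE ffunE /=.
have ji : (j == i) = false by rewrite eq_sym (negPf ij).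
have [->|ki] := eqVneq k i.
  rewrite tpermL (negPf ij) /= (eq_sym l i) (eq_sym l j).
  have [<-|il] := eqVneq i l; first by rewrite ji; case: si sj => [] [].
  by have [_|_] := eqVneq j l; case: si sj => [] [].
have [->|kj] := eqVneq k j.
  rewrite tpermR /= (eq_sym l i) (eq_sym l j).
  have [<-|jl] := eqVneq j l; first by rewrite (negPf ij); case: si sj => [] [].
  by have [_|_] := eqVneq i l; case: si sj => [] [].
rewrite tpermD 1?eq_sym //= andbF mulr0 mulr0 addr0 mul0r subr0 mul1r.
by rewrite eq_sym.
Qed.

Lemma WD6_mul U V : WD6 U -> WD6 V -> WD6 (U *m V).
Proof.
move=> [s [Ds ->]] [t [Dt ->]]; exists (s ++ t); split=> [a|].
  by rewrite mem_cat => /orP[/Ds|/Dt].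
by elim: s {Ds} => [|a s IHs] /=; rewrite ?mul1mx // -IHs mulmxA.
Qed.

Lemma WD6_refl b i j : i != j -> WD6 (spmx rat (refl_sperm b i j)).
Proof.
move=> ij; rewrite -[b]negbK -[~~ b]/(false (+) ~~ b) -reflD6E //.
eexists [:: _]; split=> [a|]; last by rewrite /= mulmx1.
by rewrite inE => /eqP->; exists i, j, false, (~~ b).
Qed.

Lemma WD6_1 : WD6 1%:M.
Proof. by exists [::]. Qed.

Lemma WD6_perm (s : 'S_6) : WD6 (spmx rat ([ffun=> false], s)).
Proof.
have [ts -> /allP dts] := prod_tpermP s.
elim: ts dts => [|[i j] ts IHts] dts.
  by rewrite big_nil -/one_sperm spmx1; apply: WD6_1.
rewrite big_cons /= (_ : (_, _) = mul_sperm (refl_sperm false i j)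
  ([ffun=> false], \prod_(t <- ts) tperm t.1 t.2)%g).
  rewrite -spmxM; apply: WD6_mul; first by apply/WD6_refl/(dts (i, j))/mem_head.
  by apply: IHts => t t_ts; apply: dts; rewrite inE t_ts orbT.
by congr (_, _); apply/ffunP => k; rewrite !ffunE.
Qed.

(** Induction on the number of minus signs, removed in pairs: changing the signs at i and j is the
    product of the reflections in e_i + e_j and e_i - e_j. *)
Lemma WD6_signs (e : {ffun 'I_6 -> bool}) :
  even_sperm (e, 1%g) -> WD6 (spmx rat (e, 1%g)).
Proof.
have [n le_n] := ubnP #|[pred i | e i]|; elim: n e le_n => // n IHn e le_n ev_e.
have [i /= ei|e0] := pickP [pred i | e i]; last first.
  rewrite (_ : (e, 1%g) = one_sperm) ?spmx1; first exact: WD6_1.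
  by congr (_, _); apply/ffunP => i; rewrite ffunE; apply: e0.
have [j /andP[ji ej]] : {j | (j != i) && e j}.
  apply/sigW/existsP; apply: contraLR ev_e; rewrite negb_exists => /forallP e0.
  rewrite /even_sperm negbK (bigD1 i) //= big1 ?addbF // => j ji.
  by have := e0 j; rewrite ji /= => /negPf.
pose flip : {ffun 'I_6 -> bool} := [ffun k => (k == i) || (k == j)].
pose e' : {ffun 'I_6 -> bool} := [ffun k => flip k (+) e k].
have flipE : (flip, 1%g) = mul_sperm (refl_sperm true j i) (refl_sperm false j i).
  by congr (_, _); rewrite ?tperm2 //; apply/ffunP => k; rewrite !ffunE /= addbF orbC.
have eE : (e, 1%g) = mul_sperm (flip, 1%g) (e', 1%g).
  congr (_, _); last by rewrite mul1g.
  by apply/ffunP => k; rewrite !ffunE perm1 addbA addbb addFb.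
have e'E : (e', 1%g) = mul_sperm (flip, 1%g) (e, 1%g).
  congr (_, _); last by rewrite mul1g.
  by apply/ffunP => k; rewrite !ffunE perm1.
have ev_flip : even_sperm (flip, 1%g).
  by rewrite flipE; apply: even_mul_sperm; apply: even_refl_sperm.
rewrite eE -spmxM; apply: WD6_mul.
  by rewrite flipE -spmxM; apply: WD6_mul; apply: WD6_refl.
apply: IHn; last by rewrite e'E; apply: even_mul_sperm.
rewrite -ltnS (leq_trans _ le_n) // ltnS; apply/proper_card/properP; split.
  apply/subsetP => k; rewrite !inE !ffunE.
  by have [->|_] := eqVneq k i; rewrite ?ei //; have [->|_] := eqVneq k j; rewrite ?ej.
by exists i; rewrite !inE // !ffunE eqxx ei.
Qed.

(** Reflections are even; conversely an even signed permutation is an even sign change times a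
    permutation, and both factors are products of reflections. *)
Lemma WD6P W : WD6 W <-> exists2 w, even_sperm w & W = spmx rat w.
Proof.
split=> [[s [Ds ->]]|[[e s] ev_w ->]].
  elim: s Ds => [|a s IHs] Ds /=.
    by exists one_sperm; rewrite ?spmx1 ?even_one_sperm.
  have [|w ev_w ->] := IHs; first by move=> b b_s; apply: Ds; rewrite inE b_s orbT.
  have [i [j [si [sj [ij ->]]]]] := Ds a (mem_head a s).
  rewrite reflD6E // spmxM; eexists; last by [].
  by apply: even_mul_sperm => //; apply: even_refl_sperm.
have -> : (e, s) = mul_sperm (e, 1%g) ([ffun=> false], s).
  congr (_, _); last by rewrite mul1g.
  by apply/ffunP => k; rewrite !ffunE addbF.
by rewrite -spmxM; apply: WD6_mul (WD6_perm s); apply: WD6_signs.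
Qed.

(** * Counting classes through finite types of representatives *)

Lemma quot_card_fin (T : Type) (P : T -> Prop) (E : T -> T -> Prop) n
    (X : finType) (g : X -> T) :
  #|X| = n -> (forall x, P (g x)) -> (forall x y, E (g x) (g y) -> x = y) ->
  (forall t, P t -> exists x, E t (g x)) -> quot_card P E n.
Proof.
move=> cX Pg gI gS; exists (fun i => g (enum_val (cast_ord (esym cX) i))).
split; first by [].
split=> [i j /gI eq_ij|t Pt].
  by apply: (@cast_ord_inj _ _ (esym cX)); apply: enum_val_inj.
have [x tx] := gS t Pt.
by exists (cast_ord cX (enum_rank x)); rewrite cast_ordK enum_rankK.
Qed.

(* The sign at [ord0] is determined by the parity condition. *)
Definition even_ext (e : {ffun 'I_5 -> bool}) : {ffun 'I_6 -> bool} :=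
  [ffun i => if unlift ord0 i is Some j then e j else \big[addb/false]_j e j].

(* Normalising one sign to [+] picks a representative modulo [-1]. *)
Definition false_ext (e : {ffun 'I_4 -> bool}) : {ffun 'I_5 -> bool} :=
  [ffun i => if unlift ord0 i is Some j then e j else false].

Lemma even_even_ext e s : even_sperm (even_ext e, s).
Proof.
rewrite /even_sperm big_ord_recl /= ffunE unlift_none.
by under [X in _ (+) X]eq_bigr do rewrite ffunE liftK; rewrite addbb.
Qed.

Lemma even_ext_inj : injective even_ext.
Proof.
move=> e e' /ffunP ee'; apply/ffunP => j.
by have := ee' (lift ord0 j); rewrite !ffunE liftK.
Qed.

Lemma false_ext_inj : injective false_ext.
Proof.
move=> e e' /ffunP ee'; apply/ffunP => j.
by have := ee' (lift ord0 j); rewrite !ffunE liftK.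
Qed.

Lemma even_extP e s : even_sperm (e, s) -> {e' | e = even_ext e'}.
Proof.
move=> ev; exists [ffun j => e (lift ord0 j)]; apply/ffunP => i; rewrite ffunE.
case: unliftP => [j|] ->; first by rewrite ffunE.
under eq_bigr do rewrite ffunE.
by apply/eqP; move: ev; rewrite /even_sperm big_ord_recl /= negb_add.
Qed.

Lemma false_extP (e : {ffun 'I_5 -> bool}) : ~~ e ord0 -> {e' | e = false_ext e'}.
Proof.
move=> e0; exists [ffun j => e (lift ord0 j)]; apply/ffunP => i; rewrite ffunE.
by case: unliftP => [j|] ->; [rewrite ffunE | apply/negbTE].
Qed.

(** * The quotient groups *)

(** Being defined over the rationals gives both rational and real entries. *)
Lemma aut_mx_rat (K : numFieldType) w : map_mx ratr (aut_mx rat w) = aut_mx K w.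
Proof.
have map_d6_coord : map_mx ratr (d6_coord rat) = d6_coord K.
  by apply/matrixP => i j; rewrite !mxE rmorphD rmorphM rmorph_sign !rmorph_nat.
by rewrite map_mxZ !map_mxM /= map_d6_coord map_spmx fmorphV rmorph_nat.
Qed.

Lemma aut_mx_real (K : numFieldType) w i j : aut_mx K w i j \is Num.real.
Proof. by rewrite -aut_mx_rat mxE rpred_rat. Qed.

Lemma sign_posZ (K : numDomainType) (c : K) (b b' : bool) :
  0 < c -> (-1) ^+ b = c * (-1) ^+ b' -> c = 1.
Proof.
move=> c_gt0; case: b b' => [] [] /=; rewrite ?expr0 ?expr1 ?mulr1 ?mulrN1 //.
- by move/oppr_inj.
- by move=> c1; move: c_gt0; rewrite -c1 oppr_gt0 ltr10.
- by move/eqP; rewrite eq_sym eqr_oppLR => /eqP c1; move: c_gt0; rewrite c1 oppr_gt0 ltr10.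
Qed.

Lemma aut_mx_pos_inj (K : numFieldType) (c : K) w w' :
  0 < c -> aut_mx K w = c *: aut_mx K w' -> c = 1 /\ w = w'.
Proof.
move=> c_gt0 /aut_mx_eqZ eqw; have [_ /(_ 0)/(sign_posZ c_gt0) c1] := spmx_eqZ eqw.
by split=> //; apply: (@spmx_inj K); rewrite eqw c1 scale1r.
Qed.

Section Quotients.
Variable R : realType.
Notation C := R[i].

(** The scalar is a quotient of real entries, hence real; a negative sign is absorbed by
    [opp_sperm]. *)
Lemma isAutRP (A : 'M[C]_6) :
  isAutR A <-> exists (k : C) (w : sperm), [/\ 0 < k, even_sperm w & A = k *: aut_mx _ w].
Proof.
split=> [[/isAutP[k [w [nz_k ev_w ->]]] rA]|[k [w [k_gt0 ev_w ->]]]]; last first.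
  split; first by apply/isAutP; exists k, w; rewrite gt_eqF.
  by move=> i j; rewrite mxE rpredM ?aut_mx_real // gtr0_real.
have [j nz_j] : exists j, aut_mx C w 0 j != 0.
  apply/existsP; apply: contraT; rewrite negb_exists => /forallP row0.
  have /matrixP/(_ 0 0)/eqP := aut_mx_tr C w; rewrite !mxE big1 => [|j _].
    by rewrite eq_sym oner_eq0.
  by have /negPn/eqP -> := row0 j; rewrite mul0r.
have k_real : k \is Num.real.
  by rewrite -(mulfK nz_j k) rpred_div ?aut_mx_real //; have := rA 0 j; rewrite mxE.
have [k_lt0|k_gt0|k0] := real_ltgtP k_real (real0 C).
- exists (- k), (opp_sperm w); rewrite oppr_gt0 even_opp_sperm aut_mxN scaleNr scalerN opprK.
  by [].
- by exists k, w.
- by rewrite k0 eqxx in nz_k.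
Qed.

Lemma rat_aut_mx w : rat_mx (aut_mx C w).
Proof. by move=> i j; exists (aut_mx rat w i j); rewrite -aut_mx_rat mxE. Qed.

(** Modulo scalars, w and its opposite coincide; requiring a plus sign at coordinate 1 leaves 2^4 *
    6! representatives. *)
Lemma card_PAut : quot_card (@isAut R) (@proj_eq R) 11520.
Proof.
pose g (x : {ffun 'I_4 -> bool} * 'S_6) : sperm := (even_ext (false_ext x.1), x.2).
apply: (@quot_card_fin _ _ _ _ _ (fun x => aut_mx C (g x))).
- by rewrite card_prod card_ffun card_bool card_ord card_Sn; vm_compute.
- move=> x; apply/isAutP; exists 1, (g x); rewrite oner_eq0 scale1r.
  by split=> //; apply: even_even_ext.
- move=> x y [c [nz_c /aut_mx_eqZ eq_xy]].
  have [eq2 /(_ (lift ord0 ord0))] := spmx_eqZ eq_xy.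
  rewrite /= !ffunE liftK !ffunE unlift_none expr0 mulr1 => /esym c1.
  move: eq_xy; rewrite c1 scale1r => /spmx_inj[/even_ext_inj/false_ext_inj].
  by case: x y {eq2} => ? ? [? ?] /= -> ->.
move=> A /isAutP[k [[e s] [nz_k ev_w ->]]].
wlog e0 : k e nz_k ev_w / ~~ e (lift ord0 ord0).
  move=> thm; have [e0|] := boolP (e (lift ord0 ord0)); last exact: thm.
  have [|||x] := thm (- k) (opp_sperm (e, s)).1.
  - by rewrite oppr_eq0.
  - by rewrite -even_opp_sperm in ev_w.
  - by rewrite ffunE e0.
  by rewrite -[(_, s)]/(opp_sperm (e, s)) aut_mxN scaleNr scalerN opprK => ex; exists x.
have [e5 eE] := even_extP ev_w.
have [|e4 e5E] := @false_extP e5; first by move: e0; rewrite eE ffunE liftK.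
by exists (e4, s), k; rewrite /g /= -e5E -eE.
Qed.

Lemma card_PAutR : quot_card (@isAutR R) (@pos_eq R) 23040.
Proof.
pose g (x : {ffun 'I_5 -> bool} * 'S_6) : sperm := (even_ext x.1, x.2).
apply: (@quot_card_fin _ _ _ _ _ (fun x => aut_mx C (g x))).
- by rewrite card_prod card_ffun card_bool card_ord card_Sn; vm_compute.
- move=> x; apply/isAutRP; exists 1, (g x); rewrite ltr01 scale1r.
  by split=> //; apply: even_even_ext.
- move=> [e s] [e' s'] [c [c_gt0 /(aut_mx_pos_inj c_gt0)[_ []]]].
  by move=> /= /even_ext_inj -> ->.
move=> A /isAutRP[k [[e s] [k_gt0 ev_w ->]]].
have [e5 eE] := even_extP ev_w.
by exists (e5, s), k; rewrite /g /= -eE.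
Qed.

(** The signed permutation is unique by [aut_mx_pos_inj]; 0 is a default value when there is
    none. *)
Definition weyl_of (A : 'M[C]_6) : 'M[rat]_6 :=
  if [pick w | even_sperm w & `[< pos_eq A (aut_mx C w) >]] is Some w
  then spmx rat w else 0.

Lemma weyl_ofE k w : 0 < k -> even_sperm w -> weyl_of (k *: aut_mx C w) = spmx rat w.
Proof.
move=> k_gt0 ev_w; rewrite /weyl_of.
case: pickP => [w' /andP[_ /asboolP[c [c_gt0 eqw]]]|/(_ w)/negP[]]; last first.
  by rewrite ev_w; apply/asboolP; exists k.
have kc_gt0 : 0 < k^-1 * c by rewrite mulr_gt0 ?invr_gt0.
have [|_ ->] := @aut_mx_pos_inj _ _ w w' kc_gt0; last by [].
by rewrite -scalerA -eqw scalerA (mulVf (lt0r_neq0 k_gt0)) scale1r.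
Qed.

Lemma weyl_ofP A : isAutR A ->
  exists (k : C) (w : sperm),
    [/\ 0 < k, even_sperm w, A = k *: aut_mx C w & weyl_of A = spmx rat w].
Proof.
case/isAutRP=> k [w [k_gt0 ev_w AE]]; exists k, w; split=> //.
by rewrite AE; apply: weyl_ofE.
Qed.

Lemma weyl_of_iso :
  [/\ forall A, isAutR A -> WD6 (weyl_of A),
      forall A B, isAutR A -> isAutR B -> weyl_of (A *m B) = weyl_of A *m weyl_of B,
      forall A B, isAutR A -> isAutR B -> (weyl_of A = weyl_of B <-> pos_eq A B) &
      forall W, WD6 W -> exists A, isAutR A /\ weyl_of A = W].
Proof.
split.
- by move=> A /weyl_ofP[k [w [_ ev_w _ ->]]]; apply/WD6P; exists w.
- move=> A B /weyl_ofP[k [w [k_gt0 ev_w AE WA]]] /weyl_ofP[k' [w' [k'_gt0 ev_w' BE WB]]].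
  transitivity (spmx rat (mul_sperm w w')); last by rewrite WA WB spmxM.
  rewrite AE BE -scalemxAl -scalemxAr scalerA aut_mxM.
  by apply: weyl_ofE; [apply: mulr_gt0 | apply: even_mul_sperm].
- move=> A B /weyl_ofP[k [w [k_gt0 ev_w AE WA]]] /weyl_ofP[k' [w' [k'_gt0 ev_w' BE WB]]].
  rewrite WA WB; split=> [/spmx_inj ww'|[c [c_gt0 eqAB]]].
    exists (k / k'); split; first exact: divr_gt0.
    rewrite AE BE scalerA (divfK (lt0r_neq0 k'_gt0)) ww'; exact: erefl.
  have ck_gt0 : 0 < k^-1 * (c * k') by rewrite !mulr_gt0 ?invr_gt0.
  have [|_ ->] := @aut_mx_pos_inj _ _ w w' ck_gt0; last by [].
  rewrite -!scalerA -BE -eqAB AE scalerA (mulVf (lt0r_neq0 k_gt0)) scale1r.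
  exact: erefl.
- move=> W /WD6P[w ev_w ->]; exists (1 *: aut_mx C w).
  split; last exact: weyl_ofE ltr01 ev_w.
  by apply/isAutRP; exists 1, w.
Qed.

End Quotients.

(** * Edge permutations *)

(** For equal vertices the index is 6, out of range, so [vedge] is meaningful only for distinct
    ones. *)
Definition edge_index (a b : nat) : nat := index (minn a b, maxn a b) edge_seq.

Lemma edge_index_check : all (fun a => all (fun b => (a == b) ||
    (edge_index a b < 6)%N && all (fun e => let: (u, v) := nth (0, 1)%N edge_seq e in
      (((a == u) && (b == v)) || ((a == v) && (b == u))) == (e == edge_index a b))
    (iota 0 6)) (iota 0 4)) (iota 0 4).
Proof. by vm_compute. Qed.

Definition vedge (a b : 'I_4) : 'I_6 := inord (edge_index a b).

Lemma vedgeP (a b : 'I_4) (e : 'I_6) : a != b ->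
  ((a == (edge e).1) && (b == (edge e).2)) || ((a == (edge e).2) && (b == (edge e).1))
  = (e == vedge a b).
Proof.
move=> ab.
have io n (k : 'I_n) : (k : nat) \in iota 0 n by rewrite mem_iota add0n ltn_ord.
have chk_a := elimT allP edge_index_check (val a) (io _ a).
have := elimT allP chk_a (val b) (io _ b).
rewrite (val_eqE a b) (negPf ab) orFb => /andP[lt6 /allP chk].
have := chk e (io _ e); rewrite -!val_eqE /= !edgeE inordK //.
by case: (nth _ _ _) => u v /= /eqP.
Qed.

Lemma edge_neq e : (edge e).1 != (edge e).2.
Proof.
rewrite -val_eqE /= !edgeE.
by case: e => [[|[|[|[|[|[|//]]]]]] lt6].
Qed.

Definition edge_act (s : 'S_4) (e : 'I_6) : 'I_6 := vedge (s (edge e).1) (s (edge e).2).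

Section EdgePermutations.
Variable R : realType.
Notation C := R[i].

Lemma edge_perm_mxE (s : 'S_4) e f : edge_perm_mx R s e f = (e == edge_act s f)%:R.
Proof.
by rewrite mxE /edge_act -vedgeP ?(inj_eq perm_inj) ?edge_neq.
Qed.

Lemma edge_perm_mxVE (s : 'S_4) e f : edge_perm_mx R s e f = (f == edge_act s^-1 e)%:R.
Proof.
rewrite mxE /edge_act -vedgeP ?(inj_eq perm_inj) ?edge_neq //.
have sE (i j : 'I_4) : (s i == j) = ((s^-1)%g j == i).
  by rewrite eq_sym (canF_eq (permKV s)) eq_sym.
rewrite !sE [X in _ || X]andbC.
by [].
Qed.

Lemma edge_perm_mx_mulv s (x : 'cV[C]_6) e :
  (edge_perm_mx R s *m x) e 0 = x (edge_act s^-1 e) 0.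
Proof.
rewrite mxE (bigD1 (edge_act s^-1 e)) //= edge_perm_mxVE eqxx mul1r.
by rewrite big1 ?addr0 // => f /negPf fe; rewrite edge_perm_mxVE fe mul0r.
Qed.

Lemma edge_act_inj s : injective (edge_act s).
Proof.
move=> e f ef; have eV g : g = edge_act s^-1 (edge_act s g).
  apply/eqP; have := edge_perm_mxVE s (edge_act s g) g; rewrite edge_perm_mxE eqxx.
  by case: (_ == _) => // /eqP; rewrite oner_eq0.
by rewrite [e]eV ef -eV.
Qed.

Lemma edge_perm_mxV s : edge_perm_mx R s *m edge_perm_mx R s^-1 = 1%:M.
Proof.
apply/matrixP => e f; rewrite mxE (bigD1 (edge_act s^-1 e)) //= edge_perm_mxVE eqxx mul1r.
rewrite big1 ?addr0 => [|g /negPf ge]; last by rewrite edge_perm_mxVE ge mul0r.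
by rewrite edge_perm_mxE (inj_eq (@edge_act_inj _)) mxE.
Qed.

(** The points of a realising configuration are relabelled. *)
Lemma L24_edge_perm s (x : 'cV[C]_6) : L24 x -> L24 (edge_perm_mx R s *m x).
Proof.
move=> [p xp]; exists (row_perm s^-1%g p); apply/colP => e.
rewrite [LHS]mxE edge_perm_mx_mulv mK4E ![row_perm _ _ _ _]mxE.
set f := edge_act s^-1 e.
have -> : x f 0 ^+ 2 = mK4 p f 0 by rewrite -xp mxE.
rewrite mK4E; have : f == vedge ((s^-1)%g (edge e).1) ((s^-1)%g (edge e).2) by [].
rewrite -vedgeP ?(inj_eq perm_inj) ?edge_neq //.
by move=> /orP[] /andP[/eqP-> /eqP->] //; congr (_ + _); rewrite -sqrrN opprB.
Qed.

Lemma isAut_edge_perm s : isAut (edge_perm_mx R s).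
Proof.
split; first by have [] := mulmx1_unit (edge_perm_mxV s).
move=> y; split=> [Ly|[x [Lx ->]]]; last exact: L24_edge_perm.
exists (edge_perm_mx R s^-1 *m y); rewrite mulmxA edge_perm_mxV mul1mx.
by split=> //; apply: L24_edge_perm.
Qed.

Lemma nonneg_edge_perm s : isAutR (edge_perm_mx R s) /\ nonneg_mx (edge_perm_mx R s).
Proof.
split; last by move=> e f; rewrite edge_perm_mxE ler0n.
by split; [exact: isAut_edge_perm | move=> e f; rewrite edge_perm_mxE realn].
Qed.

(** Edges ij have the same image under both, so if s i differs from t i, then s i = t j for every
    other vertex j; two choices of j contradict injectivity. *)
Lemma edge_perm_mx_inj s t : pos_eq (edge_perm_mx R s) (edge_perm_mx R t) -> s = t.
Proof.
move=> [c [_ eq_st]].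
have act_eq f : edge_act s f = edge_act t f.
  apply/eqP; move/matrixP/(_ (edge_act s f) f)/eqP: eq_st.
  rewrite [X in _ == X]mxE !edge_perm_mxE eqxx.
  by case: (_ == edge_act t f) => //; rewrite mulr0 oner_eq0.
have in_pair (i j : 'I_4) : i != j -> (s i == t i) || (s i == t j).
  move=> ij; pose e := vedge i j; pose e' := edge_act t e.
  have ends (u : 'S_4) : edge_act u e = e' ->
      ((u (edge e).1 == (edge e').1) && (u (edge e).2 == (edge e').2)) ||
      ((u (edge e).1 == (edge e').2) && (u (edge e).2 == (edge e').1)).
    by move=> <-; rewrite vedgeP ?(inj_eq perm_inj) ?edge_neq.
  have := vedgeP e ij; rewrite eqxx.
  by case/orP=> /andP[/eqP iE /eqP jE]; rewrite iE jE;
    case/orP: (ends s (act_eq e)) => /andP[/eqP s1 /eqP s2];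
    case/orP: (ends t erefl) => /andP[/eqP t1 /eqP t2];
    rewrite ?s1 ?s2 ?t1 ?t2 eqxx ?orbT.
apply/permP => i.
have [j [k [ij ik jk]]] : exists j k : 'I_4, [/\ i != j, i != k & j != k].
  exists (inord (i.+1 %% 4)), (inord (i.+2 %% 4)); rewrite -!val_eqE /= !inordK ?ltn_pmod //.
  by case: i => [[|[|[|[|//]]]] ?].
have /orP[/eqP//|/eqP sij] := in_pair i j ij.
have /orP[/eqP//|/eqP sik] := in_pair i k ik.
by move: jk; rewrite -(inj_eq (@perm_inj _ t)) -sij sik eqxx.
Qed.

End EdgePermutations.

(** * Non-negative automorphisms *)

Lemma rmorph_cayley_menger (K K' : comNzRingType) (f : {rmorphism K -> K'}) z :
  f (cayley_menger z) = cayley_menger (f \o z).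
Proof.
rewrite /cayley_menger /= !(rmorphB, rmorphD, rmorphM, rmorph1) /=.
ring.
Qed.

Lemma eq_cayley_menger (K : comNzRingType) (z z' : nat -> K) :
  (forall n, (n < 6)%N -> z n = z' n) -> cayley_menger z = cayley_menger z'.
Proof. by move=> zz'; rewrite /cayley_menger !zz'. Qed.

(* Membership in L_{2,4} of the indicator vector of [S], see [L24_flat]. *)
Definition flat_edges (S : seq nat) : bool :=
  cayley_menger (fun n => (n \in S)%:R : int) == 0.

Lemma opposite_check :
  all (fun a => all (fun b => flat_edges [:: a; b] || (b == 5 - a)%N) (iota 0 6)) (iota 0 6).
Proof. by vm_compute. Qed.

(** Images of all six edges from those of edges 0, 1, 2, if opposite edges stay opposite; edges 3,
    4, 5 are opposite to 2, 1, 0, hence the reversal. *)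
Definition opp_closure (t : seq nat) : seq nat := t ++ rev [seq (5 - a)%N | a <- t].

(** Three edges from distinct opposite pairs form a star or a triangle, and only stars have a flat
    indicator. Edges 0, 1, 2 are the star at vertex 0, and [l] lists the images of the vertices. *)
Lemma star_check : all (fun a => all (fun b => all (fun c =>
    uniq (opp_closure [:: a; b; c]) && flat_edges [:: a; b; c] ==>
    has (fun l => all (fun f => let: (u, v) := nth (0, 1)%N edge_seq f in
          edge_index (nth 0 l u) (nth 0 l v) == nth 0 (opp_closure [:: a; b; c]) f)%N
        (iota 0 6)) (permutations (iota 0 4)))
  (iota 0 6)) (iota 0 6)) (iota 0 6).
Proof. by vm_compute. Qed.

Section NonNegative.
Variable R : realType.
Notation C := R[i].

Lemma L24_flat (k : C) (S : seq nat) :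
  k != 0 -> L24 (k *: \col_(e < 6) (val e \in S)%:R) <-> flat_edges S.
Proof.
move=> nz_k; rewrite L24P -scalemxAr vsexticZ vsextic_d6_coord.
rewrite (_ : cayley_menger _ = (cayley_menger (fun n => (n \in S)%:R : int))%:~R).
  rewrite /flat_edges; split=> [/eqP|/eqP->]; last by rewrite !mulr0.
  by rewrite mulf_eq0 expf_eq0 (negPf nz_k) /= mulf_eq0 oppr_eq0 pnatr_eq0 /= intr_eq0.
rewrite rmorph_cayley_menger; apply: eq_cayley_menger => n lt6 /=.
by rewrite mxE inordK // rmorph_nat -natrX; case: (n \in S).
Qed.

(** Distinct rows are orthogonal, and a zero sum of non-negative terms has zero terms; so no column
    has two nonzero entries. *)
Lemma nonneg_monomial (k : C) w : 0 < k -> nonneg_mx (k *: aut_mx C w) ->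
  exists r : 'S_6, forall e f, (k *: aut_mx C w) e f = k * (r e == f)%:R.
Proof.
move=> k_gt0; have : (k *: aut_mx C w) *m (k *: aut_mx C w)^T = (k ^+ 2)%:M.
  rewrite -scalemxAl (_ : (k *: aut_mx C w)^T = k *: (aut_mx C w)^T); last exact: linearZ.
  by rewrite -scalemxAr aut_mx_tr scalerA scale_scalar_mx mulr1.
move: (k *: aut_mx C w) => A AAT A_ge0.
have row_prod i j : \sum_f A i f * A j f = (k ^+ 2) *+ (i == j).
  have /matrixP/(_ i j) := AAT; rewrite !mxE => <-.
  by apply: eq_bigr => f _; rewrite mxE.
have prod0 i j f : i != j -> A i f * A j f = 0.
  move=> ij; apply/eqP; have /eqP := row_prod i j; rewrite (negPf ij) mulr0n.
  rewrite psumr_eq0 => [/allP/(_ f)|g _]; last by rewrite mulr_ge0.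
  by rewrite mem_index_enum => /(_ isT).
have row_nz i : exists f, A i f != 0.
  apply/existsP; apply: contraT; rewrite negb_exists => /forallP row0.
  have /eqP := row_prod i i; rewrite eqxx mulr1n big1 => [|f _].
    by rewrite eq_sym expf_eq0 (gt_eqF k_gt0).
  by have /negPn/eqP -> := row0 f; rewrite mul0r.
pose r i := xchoose (row_nz i).
have rP i : A i (r i) != 0 by apply: (xchooseP (row_nz i)).
have r_inj : injective r.
  move=> i j rij; apply/eqP; apply: contraT => /(prod0 _ _ (r i))/eqP.
  by rewrite mulf_eq0 (negPf (rP i)) rij (negPf (rP j)).
exists (perm r_inj) => e f; rewrite permE.
have A0 g : r e != g -> A e g = 0.
  pose j := (perm r_inj)^-1%g g; have rj : r j = g by rewrite -[r j](permE r_inj) permKV.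
  rewrite -rj (inj_eq r_inj) => /(prod0 _ _ (r j))/eqP.
  by rewrite mulf_eq0 (negPf (rP j)) orbF => /eqP.
have [<-|/A0->] := eqVneq (r e) f; last by rewrite mulr0.
rewrite mulr1; apply/eqP.
rewrite -(eqrXn2 (isT : (0 < 2)%N) (A_ge0 _ _) (ltW k_gt0)).
have /eqP := row_prod e e; rewrite eqxx mulr1n (bigD1 (r e)) //= big1 ?addr0 -?expr2 //.
by move=> g; rewrite eq_sym => /A0->; rewrite mul0r.
Qed.

Lemma nonneg_edge_permP (A : 'M[C]_6) : isAutR A -> nonneg_mx A ->
  exists s : 'S_4, pos_eq A (edge_perm_mx R s).
Proof.
move=> autA A_ge0; have [k [w [k_gt0 _ AE]]] := (isAutRP A).1 autA.
have [r rE] : exists r : 'S_6, forall e f, A e f = k * (r e == f)%:R.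
  by rewrite AE; apply: nonneg_monomial => //; rewrite -AE.
case: autA => -[uA LA] _; clear AE w.
have nz_k := lt0r_neq0 k_gt0.
(* Column n of [A] is supported on row [t n], so [A] sends indicator vectors to multiples of
   indicator vectors and [t] preserves flatness in both directions. *)
pose t n : nat := (r^-1)%g (inord n : 'I_6).
have t_lt n : (t n < 6)%N by rewrite ltn_ord.
have tE (e : 'I_6) n : (n < 6)%N -> (val (r e) == n) = (val e == t n).
  move=> n6; rewrite /t val_eqE -(inj_eq (@perm_inj _ r)) permKV.
  by rewrite -val_eqE /= inordK.
have flat_t S : all (fun n => n < 6)%N S -> flat_edges [seq t n | n <- S] = flat_edges S.
  move=> S6; pose x : 'cV[C]_6 := \col_(e < 6) (val e \in S)%:R.
  have Ax : A *m x = k *: \col_(e < 6) (val e \in [seq t n | n <- S])%:R.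
    apply/colP => e; rewrite mxE (bigD1 (r e)) //= big1 ?addr0 => [|f fe].
      rewrite rE eqxx mulr1 !mxE; congr (k * (nat_of_bool _)%:R).
      elim: S S6 {x} => //= n S IHS /andP[n6 S6].
      by rewrite !inE IHS // tE.
    by rewrite rE eq_sym (negPf fe) mulr0 mul0r.
  apply/idP/idP => [/(L24_flat _ nz_k)|/(L24_flat _ (oner_neq0 C))]; rewrite -?Ax ?scale1r.
    case/LA=> y [Ly] /(congr1 (mulmx (invmx A))); rewrite !mulKmx // => xy.
    by apply/(L24_flat _ (oner_neq0 C)); rewrite scale1r -/x xy.
  by move=> Lx; apply/(L24_flat _ nz_k); rewrite -Ax; apply/LA; exists x.
have opp_t a b : (a < 6)%N -> (b < 6)%N -> ~~ flat_edges [:: a; b] -> t b = (5 - t a)%N.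
  move=> a6 b6; rewrite -flat_t /= ?a6 ?b6 // => nflat.
  have io n : (t n) \in iota 0 6 by rewrite mem_iota add0n t_lt.
  have := elimT allP (elimT allP opposite_check _ (io a)) _ (io b).
  by rewrite (negPf nflat) => /eqP.
have t5 := opp_t 0%N 5%N isT isT isT; have t4 := opp_t 1%N 4%N isT isT isT.
have t3 := opp_t 2%N 3%N isT isT isT.
have tT : opp_closure [:: t 0; t 1; t 2]%N = [seq t n | n <- iota 0 6].
  by rewrite /= t3 t4 t5.
have t_uniq : uniq [seq t n | n <- iota 0 6].
  rewrite map_inj_in_uniq ?iota_uniq // => m n; rewrite !mem_iota /= => m6 n6.
  move=> /val_inj/perm_inj/(congr1 val) /=; rewrite !inordK //.
have flat012 : flat_edges [:: t 0; t 1; t 2]%N.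
  by rewrite (flat_t [:: 0; 1; 2]%N) //; vm_compute.
have io n : (t n) \in iota 0 6 by rewrite mem_iota add0n t_lt.
have := elimT allP (elimT allP (elimT allP star_check _ (io 0%N)) _ (io 1%N)) _ (io 2%N).
rewrite tT t_uniq flat012 => /hasP[l]; rewrite mem_permutations => l_perm /allP l_edge.
have l4 : size l = 4%N by rewrite (perm_size l_perm).
have l_uniq : uniq l by rewrite (perm_uniq l_perm) iota_uniq.
have l_lt (i : 'I_4) : (nth 0 l i < 4)%N.
  have : nth 0%N l i \in l by rewrite mem_nth // l4.
  by rewrite (perm_mem l_perm) mem_iota.
have s_inj : injective (fun i : 'I_4 => inord (nth 0%N l i) : 'I_4).
  move=> i j /(congr1 val) /=; rewrite !inordK // => /eqP.
  by rewrite nth_uniq ?l4 // => /eqP/val_inj.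
exists (perm s_inj), k; split=> //; apply/matrixP => e f.
rewrite rE [RHS]mxE edge_perm_mxE; congr (_ * (nat_of_bool _)%:R).
suff tf : edge_act (perm s_inj) f = t f :> nat.
  by rewrite -val_eqE /= (tE e f (ltn_ord f)) -tf val_eqE.
have := l_edge f; rewrite mem_iota add0n ltn_ord => /(_ isT).
rewrite (nth_map 0%N) ?size_iota // nth_iota // add0n.
have := edgeE f; case: (nth (0, 1)%N edge_seq f) => u v [/= <- <-] /eqP lf.
rewrite /edge_act /vedge !permE [LHS]inordK.
  by rewrite !inordK.
by rewrite !inordK // lf.
Qed.

End NonNegative.

(** * Closure under products and assembly of the three claims *)

Lemma isAutR_mul (R : realType) (A B : 'M[R[i]]_6) :
  isAutR A -> isAutR B -> isAutR (A *m B).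
Proof.
move=> /isAutRP[k [w [k_gt0 ev_w ->]]] /isAutRP[k' [w' [k'_gt0 ev_w' ->]]].
apply/isAutRP; exists (k * k'), (mul_sperm w w'); split.
- exact: mulr_gt0.
- exact: even_mul_sperm.
- rewrite -scalemxAl -scalemxAr scalerA aut_mxM; exact: erefl.
Qed.

Lemma pos_eq_refl (R : realType) (A : 'M[R[i]]_6) : pos_eq A A.
Proof. by exists 1; rewrite ltr01 scale1r. Qed.

Theorem theorem5p15 (R : realType) :
  (* (1) |P Aut(L_{2,4})| = 11520, generated by classes of rational automorphisms *)
  (quot_card (@isAut R) (@proj_eq R) 11520 /\
   (forall A : 'M[R[i]]_6, isAut A ->
      exists (c : R[i]) (s : seq 'M[R[i]]_6),
        c != 0 /\ (forall B, B \in s -> isAut B /\ rat_mx B) /\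
        A = c *: foldr (fun B M => B *m M) 1%:M s)) /\
  (* (2) |P_+ Aut_R(L_{2,4})| = 23040 and it is isomorphic to W(D_6) *)
  (quot_card (@isAutR R) (@pos_eq R) 23040 /\
   exists phi : 'M[R[i]]_6 -> 'M[rat]_6,
     (forall A, isAutR A -> WD6 (phi A)) /\
     (forall A B, isAutR A -> isAutR B -> phi (A *m B) = phi A *m phi B) /\
     (forall A B, isAutR A -> isAutR B -> (phi A = phi B <-> pos_eq A B)) /\
     (forall W, WD6 W -> exists A, isAutR A /\ phi A = W)) /\
  (* (3) the non-negative classes form a subgroup of order 24, consisting
         exactly of the classes of the edge permutations induced by S_4 *)
  (let N := fun A : 'M[R[i]]_6 => isAutR A /\ nonneg_mx A in
   (N 1%:M /\
    (forall A B, N A -> N B -> exists D, N D /\ pos_eq (A *m B) D) /\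
    (forall A, N A -> exists D, N D /\ pos_eq (invmx A) D)) /\
   quot_card N (@pos_eq R) 24 /\
   (forall sigma : 'S_4, N (edge_perm_mx R sigma)) /\
   (forall A, N A -> exists sigma : 'S_4, pos_eq A (edge_perm_mx R sigma))).
Proof.
split.
  split; first exact: card_PAut.
  (* Every class already contains a rational automorphism, so a word of length one suffices. *)
  move=> A /isAutP[k [w [nz_k ev_w AE]]]; exists k, [:: aut_mx _ w]; split=> //.
  split=> [B|]; last by rewrite /= mulmx1.
  rewrite inE => /eqP->; split; last exact: rat_aut_mx.
  by apply/isAutP; exists 1, w; rewrite oner_eq0 scale1r.
split.
  split; first exact: card_PAutR.
  by exists (@weyl_of R); have [h1 h2 h3 h4] := weyl_of_iso R.
move=> N.
have N_edge (s : 'S_4) : N (edge_perm_mx R s) by apply: nonneg_edge_perm.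
have NP A : N A -> exists s : 'S_4, pos_eq A (edge_perm_mx R s).
  by case; apply: nonneg_edge_permP.
split; last split; last by [].
- split; first split.
  + by apply/isAutRP; exists 1, one_sperm; rewrite ltr01 even_one_sperm aut_mx1 scale1r.
  + by move=> i j; rewrite mxE ler0n.
  split=> [A B [autA A_ge0] [autB B_ge0]|A NA].
    exists (A *m B); split; last exact: pos_eq_refl.
    split; first exact: isAutR_mul.
    by move=> i j; rewrite mxE sumr_ge0 // => l _; rewrite mulr_ge0.
  have [s [c [c_gt0 AE]]] := NP A NA.
  exists (edge_perm_mx R s^-1); split=> //; exists c^-1; split; first by rewrite invr_gt0.
  have uA : A \in unitmx by case: NA => -[[]].
  apply: (can_inj (mulKmx uA)); rewrite mulmxV // AE -scalemxAl -scalemxAr scalerA.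
  by rewrite edge_perm_mxV (mulfV (lt0r_neq0 c_gt0)) scale1r.
- apply: (@quot_card_fin _ _ _ _ _ (edge_perm_mx R)) => //.
  + by rewrite card_Sn.
  + exact: edge_perm_mx_inj.
Qed.
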